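(* Let $L,\rho_{\max},q_{\max}>0$, and let $F$, $\delta\in(0,\rho_{\max}]$ and $f(\rho):=F(\rho,1)$ be as in the context. Suppose that $f\in C^2([0,\rho_{\max}];[0,q_{\max}])$ is such that there exists $\rho_{cr}\in(0,\rho_{\max})$ with: (i) $f'(\rho)>0$ for all $\rho\in[0,\rho_{cr})$ and $f'(\rho_{cr})=0$; (ii) $f''(\rho)<0$ for all $\rho\in[0,\rho_{\max}]$; (iii) $f(0)=0$ and $f(\rho)>0$ for all $\rho\in(0,\rho_{\max}]$. Let $\rho^*\in(0,\min(\delta,\rho_{cr},\rho_{\max}/2))$ be a given constant. Then there exist constants $\sigma,\gamma,c>0$ such that for every $\rho_0\in C^1([0,L];(0,\rho_{\max}])$ with $\rho_0(0)=\rho^*$ and $$f(\rho^* )+\sigma\int_0^x(\rho_0(s)-\rho^* )\,ds-\gamma\frac{x^2}{2}\|\rho_0-\rho^*\|_\infty\le f(\rho_0(x))\quad\text{for all } x\in[0,L],$$ the initial-boundary value problem $$\frac{\partial \rho}{\partial t}(t,x)+\frac{\partial}{\partial x}\big(u(t,x)f(\rho(t,x))\big)=0,\quad t\ge 0,\ x\in[0,L],$$ $$\rho(t,0)=\rho^*,\quad t\ge0,\qquad \rho[0]=\rho_0,$$ with $$u(t,x)=\frac{1}{f(\rho(t,x))}\left(f(\rho^* )+\sigma\int_0^x(\rho(t,s)-\rho^* )\,ds-\gamma\frac{x^2}{2}\|\rho[t]-\rho^*\|_\infty\right),\quad t\ge0,\ x\in[0,L],$$ has a unique solution $\rho\in C^1(\mathbb{R}_+\times[0,L];(0,\rho_{\max}])$,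 and this solution satisfies $$\|\rho[t]-\rho^*\|_\infty\le\exp(-ct)\,\|\rho_0-\rho^*\|_\infty\quad\text{for all } t\ge0,$$ $$\lim_{t\to+\infty}u(t,x)=1\quad\text{for all } x\in[0,L],$$ $$0<u(t,x)\le1\quad\text{for all } t\ge0,\ x\in[0,L].$$
   Context: Notation. $\mathbb{R}_+=[0,+\infty)$. For a set $U\subseteq\mathbb{R}^n$ with non-empty interior and $\Omega\subseteq\mathbb{R}$, $C^0(U;\Omega)$ is the class of continuous maps $U\to\Omega$, and $C^k(U;\Omega)$, $k\ge1$, is the class of continuous functions $U\to\Omega$ having continuous derivatives of order $k$ on $U$. For $\rho:I\times[0,L]\to\mathbb{R}$ with $I$ an interval and $t\in I$, $\rho[t]$ denotes the function $x\mapsto\rho(t,x)$ on $[0,L]$. For $\rho\in C^0([0,L];\mathbb{R})$ and $\rho^*\in\mathbb{R}$, $\|\rho-\rho^*\|_\infty:=\max_{0\le x\le L}|\rho(x)-\rho^*|$. Solutions are classical: the PDE holds pointwise. Standing setting. $F\in C^2([0,\rho_{\max}]\times[0,1];[0,q_{\max}])$ satisfies $F(0,l)=F(\rho,0)=0$ for all $(\rho,l)\in[0,\rho_{\max}]\times[0,1]$ and $F(\rho,l)>0$ for all $(\rho,l)\in(0,\rho_{\max}]\times(0,1]$. There exist a continuous function $\tilde l:(0,\rho_{\max}]\to(0,1]$ and a constant $\delta\in(0,\rho_{\max}]$ such that $\frac{\partial F}{\partial l}(\rho,l)>0$ for all $\rho\in(0,\rho_{\max}]$ and $l\in(0,\tilde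 l(\rho))$; $F(\rho,\tilde l(\rho))=F(\rho,1)$ for all $\rho\in(0,\rho_{\max}]$; and $\tilde l(\rho)=1$ for all $\rho\in(0,\delta]$. The constant $\delta$ in the claim is this one, and $f(\rho):=F(\rho,1)$ for $\rho\in[0,\rho_{\max}]$. *)

(* Defs.v *)
From Stdlib Require Import Reals.
From Coquelicot Require Import Coquelicot.
Open Scope R_scope.

(* Functions are total on R; only their values on the stated domains are
   constrained. All domains below are intervals of positive length or products
   of two such intervals. *)

(* Derivative relative to D (hence one-sided at an endpoint of D): this is
   Coquelicot's [is_derive] with [locally x] restricted to D. *)
Definition is_derive_on (D : R -> Prop) (f : R -> R) (x l : R) : Prop :=
  filterdiff (K := R_AbsRing) (U := R_NormedModule) (V := R_NormedModule)
    f (within D (locally x)) (fun h => scal h l).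

Fixpoint Ck_on (k : nat) (D : R -> Prop) (f : R -> R) : Prop :=
  continuous_on D f /\
  match k with
  | O => True
  | S k' => exists f' : R -> R,
      (forall x, D x -> is_derive_on D f x (f' x)) /\ Ck_on k' D f'
  end.

Fixpoint Ck_on2 (k : nat) (D1 D2 : R -> Prop) (g : R -> R -> R) : Prop :=
  continuous_on (fun p : R * R => D1 (fst p) /\ D2 (snd p))
                (fun p : R * R => g (fst p) (snd p)) /\
  match k with
  | O => True
  | S k' => exists g1 g2 : R -> R -> R,
      (forall s y, D1 s -> D2 y ->
         is_derive_on D1 (fun s' => g s' y) s (g1 s y) /\
         is_derive_on D2 (fun y' => g s y') y (g2 s y)) /\
      Ck_on2 k' D1 D2 g1 /\ Ck_on2 k' D1 D2 g2
  end.

Definition segment (a b : R) : R -> Prop := fun x => a <= x <= b.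
Definition lopen_segment (a b : R) : R -> Prop := fun x => a < x <= b.
Definition Rplus_set : R -> Prop := fun t => 0 <= t.

(* For g continuous on [0,L] the supremum is attained, so this is
   max_{0 <= x <= L} |g x - r|. *)
Definition sup_dist (L : R) (g : R -> R) (r : R) : R :=
  real (Lub_Rbar (fun y => exists x, segment 0 L x /\ y = Rabs (g x - r))).

Record flux_setting (rho_max q_max : R) (F : R -> R -> R)
    (ltilde : R -> R) (delta : R) : Prop := {
  F_C2 : Ck_on2 2 (segment 0 rho_max) (segment 0 1) F;
  F_range : forall rho l, segment 0 rho_max rho -> segment 0 1 l ->
    segment 0 q_max (F rho l);
  F_zero : forall rho l, segment 0 rho_max rho -> segment 0 1 l ->
    F 0 l = 0 /\ F rho 0 = 0;
  F_pos : forall rho l, lopen_segment 0 rho_max rho -> lopen_segment 0 1 l ->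
    0 < F rho l;
  ltilde_cont : continuous_on (lopen_segment 0 rho_max) ltilde;
  ltilde_range : forall rho, lopen_segment 0 rho_max rho ->
    lopen_segment 0 1 (ltilde rho);
  delta_range : lopen_segment 0 rho_max delta;
  (* l lies in the interior of [0,1], so the two-sided derivative applies. *)
  F_incr : forall rho l, lopen_segment 0 rho_max rho -> 0 < l < ltilde rho ->
    0 < Derive (fun l' => F rho l') l;
  F_ltilde : forall rho, lopen_segment 0 rho_max rho ->
    F rho (ltilde rho) = F rho 1;
  ltilde_one : forall rho, lopen_segment 0 delta rho -> ltilde rho = 1
}.

(* Applied to the profiles rho[t] and rho_0. *)
Definition feedback_flow (L rho_star sigma gamma : R) (f : R -> R)
    (r : R -> R) (x : R) : R :=
  f rho_star + sigma * RInt (fun s => r s - rho_star) 0 x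
  - gamma * (x ^ 2 / 2) * sup_dist L r rho_star.

Definition feedback_u (L rho_star sigma gamma : R) (f : R -> R)
    (rho : R -> R -> R) (t x : R) : R :=
  1 / f (rho t x) * feedback_flow L rho_star sigma gamma f (rho t) x.

Record is_classical_solution (L rho_max rho_star sigma gamma : R) (f : R -> R)
    (rho0 : R -> R) (rho : R -> R -> R) : Prop := {
  sol_C1 : Ck_on2 1 Rplus_set (segment 0 L) rho;
  sol_range : forall t x, Rplus_set t -> segment 0 L x ->
    lopen_segment 0 rho_max (rho t x);
  sol_pde : forall t x, Rplus_set t -> segment 0 L x ->
    exists dt_rho dx_flow : R,
      is_derive_on Rplus_set (fun s => rho s x) t dt_rho /\
      is_derive_on (segment 0 L)
        (fun y => feedback_u L rho_star sigma gamma f rho t y * f (rho t y))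
        x dx_flow /\
      dt_rho + dx_flow = 0;
  sol_boundary : forall t, Rplus_set t -> rho t 0 = rho_star;
  sol_initial : forall x, segment 0 L x -> rho 0 x = rho0 x
}.

(* Main.v *)
Require Import Defs.
From Stdlib Require Import Reals Lra.
From Coquelicot Require Import Coquelicot.
Open Scope R_scope.

(** Let [w = rho - rho_star] and let [v(t)] be the maximum of [|w(t,x)|] over [x].
Where [f(rho) > 0], the controlled flux [u f(rho)] equals the feedback flow, whose derivative
in [x] is [sigma w - gamma x v(t)]. The conservation law thus loses its [x]-derivatives
and becomes [w_t = - sigma w + gamma x v(t)], in which different points [x] interact only
through [v]. After multiplication by [exp (sigma t)],

   [exp (sigma t) w(t,x) = w(0,x) + gamma x y(t)],   [y' = exp (sigma t) v],   [y(0) = 0],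

and taking the maximum over [x] shows that the amplitude [y] solves the scalar equation
[y' = ramp_norm y], where [ramp_norm y] is the maximum over [x] of [|w(0,x) + gamma x y|].
This right-hand side is Lipschitz with constant [gamma L]. Existence comes from a
global solution of the scalar equation ([lipschitz_ode_solution]), and uniqueness
from the fact that every classical solution has the form above
([classical_solution_is_ramp], [lipschitz_ode_unique]).

Decay: since [ramp_norm] has slope at most [gamma L], Gronwall's inequality gives
[v(t) <= exp (- (sigma - gamma L) t) v(0)] ([ramp_solution_decay]), so [c = sigma - gamma L]
works. The density stays positive because [y >= 0], and it stays at most [rho_max]
because [v] never exceeds [rho_max - rho_star].

Speed: the flow differs from [f(rho_star)] by at most [2 sigma L v(t)]. For small [sigma]
it is positive, and as [v] vanishes in the limit, [u] tends to [1]. The delicate bound is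
[u <= 1], that is, [flow <= f(rho)], which is assumed at time [0] and has to be propagated.
By concavity of [f], the gap multiplied by [exp (sigma t)] stays above its initial value,
provided that [sigma] and [gamma / sigma] are small ([choose_gains], [flow_admissible]). *)

(** * Calculus relative to an interval *)

Lemma norm_remainder (f : R -> R) (x y l : R) :
  norm (minus (minus (f y) (f x)) (scal (minus y x) l)) = Rabs (f y - f x - l * (y - x)).
Proof.
unfold norm, minus, plus, opp, scal; simpl; unfold abs, mult; simpl; f_equal; ring.
Qed.

(** The difference-quotient form of the relative derivative. The only point to
check is that [x] itself is the sole limit of the filter of neighbourhoods of [x]
in [D]; this uses [D x]. *)
Lemma is_derive_on_intro (D : R -> Prop) (f : R -> R) (x l : R) :
  D x ->
  (forall eps, 0 < eps -> exists d, 0 < d /\ forall y, D y -> Rabs (y - x) < d ->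
     Rabs (f y - f x - l * (y - x)) <= eps * Rabs (y - x)) ->
  is_derive_on D f x l.
Proof.
intros hx H; split; [exact (is_linear_scal_l (K := R_AbsRing) (V := R_NormedModule) l)|].
intros x' hx' eps.
assert (E : x' = x).
{ destruct (Req_dec x' x) as [e|ne]; [exact e|exfalso].
  assert (hp : 0 < Rabs (x - x')) by (apply Rabs_pos_lt; lra).
  specialize (hx' (ball x' (mkposreal _ hp)) (locally_ball _ _)).
  destruct hx' as [d hd].
  specialize (hd x (ball_center x d) hx).
  unfold ball in hd; simpl in hd; unfold AbsRing_ball, abs, minus, plus, opp in hd.
  simpl in hd; unfold Rminus in *; lra. }
subst x'.
destruct (H eps (cond_pos eps)) as (d & hd & K).
exists (mkposreal d hd); intros y hy Dy.
specialize (K y Dy hy).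
rewrite <- norm_remainder in K; exact K.
Qed.

Lemma is_derive_on_elim (D : R -> Prop) (f : R -> R) (x l eps : R) :
  is_derive_on D f x l -> 0 < eps ->
  exists d, 0 < d /\ forall y, D y -> Rabs (y - x) < d ->
     Rabs (f y - f x - l * (y - x)) <= eps * Rabs (y - x).
Proof.
intros [_ H] he.
destruct (H x (fun P => filter_le_within D P) (mkposreal _ he)) as [d hd].
exists d; split; [apply cond_pos|]; intros y Dy hy; specialize (hd y hy Dy).
rewrite <- norm_remainder; exact hd.
Qed.

Lemma is_derive_intro (f : R -> R) (x l : R) :
  (forall eps, 0 < eps -> exists d, 0 < d /\ forall y, Rabs (y - x) < d ->
     Rabs (f y - f x - l * (y - x)) <= eps * Rabs (y - x)) ->
  is_derive f x l.
Proof.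
intros H.
destruct (is_derive_on_intro (fun _ => True) f x l I) as [Hl Hd].
{ intros eps he; destruct (H eps he) as (d & hd & K); exists d; auto. }
split; [exact Hl|]; intros y hy eps.
assert (hy' : is_filter_lim (within (fun _ : R => True) (locally x)) y)
  by (intros P hP; apply filter_le_within; auto).
eapply filter_imp; [|exact (Hd y hy' eps)]; cbv beta; auto.
Qed.

Lemma is_derive_is_derive_on (D : R -> Prop) (f g : R -> R) (x l : R) :
  D x -> (forall y, D y -> g y = f y) -> is_derive f x l -> is_derive_on D g x l.
Proof.
intros hx hfg H; apply is_derive_on_intro; auto; intros eps he.
destruct H as [_ H].
destruct (H x (fun P hP => hP) (mkposreal _ he)) as [d hd].
exists d; split; [apply cond_pos|]; intros y Dy hy; specialize (hd y hy).
rewrite !hfg by auto.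
rewrite <- norm_remainder; exact hd.
Qed.

Lemma is_derive_on_ext (D : R -> Prop) (f g : R -> R) (x l : R) :
  D x -> (forall y, D y -> g y = f y) -> is_derive_on D f x l -> is_derive_on D g x l.
Proof.
intros hx hfg H; apply is_derive_on_intro; auto; intros eps he.
destruct (is_derive_on_elim _ _ _ _ eps H he) as (d & hd & K).
exists d; split; auto; intros y Dy hy; rewrite !hfg by auto; auto.
Qed.

(** One-sided derivatives at an endpoint are unique as well: it is enough that [x] be
an accumulation point of the domain. *)
Lemma is_derive_on_unique (D : R -> Prop) (f : R -> R) (x l1 l2 : R) :
  (forall d, 0 < d -> exists y, D y /\ y <> x /\ Rabs (y - x) < d) ->
  is_derive_on D f x l1 -> is_derive_on D f x l2 -> l1 = l2.
Proof.
intros hD H1 H2.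
destruct (Req_dec l1 l2) as [e|ne]; [exact e|exfalso].
assert (he : 0 < Rabs (l1 - l2) / 3) by (assert (0 < Rabs (l1 - l2)) by (apply Rabs_pos_lt; lra); lra).
destruct (is_derive_on_elim _ _ _ _ _ H1 he) as (d1 & hd1 & K1).
destruct (is_derive_on_elim _ _ _ _ _ H2 he) as (d2 & hd2 & K2).
destruct (hD (Rmin d1 d2)) as (y & Dy & nyx & hy); [now apply Rmin_glb_lt|].
specialize (K1 y Dy (Rlt_le_trans _ _ _ hy (Rmin_l _ _))).
specialize (K2 y Dy (Rlt_le_trans _ _ _ hy (Rmin_r _ _))).
assert (hp : 0 < Rabs (y - x)) by (apply Rabs_pos_lt; lra).
assert (T := Rabs_triang (f y - f x - l2 * (y - x)) (- (f y - f x - l1 * (y - x)))).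
rewrite Rabs_Ropp in T.
replace (f y - f x - l2 * (y - x) + - (f y - f x - l1 * (y - x))) with ((l1 - l2) * (y - x)) in T by ring.
rewrite Rabs_mult in T.
nra.
Qed.

Lemma is_derive_on_continuous_on (D : R -> Prop) (f f' : R -> R) :
  (forall x, D x -> is_derive_on D f x (f' x)) -> continuous_on D f.
Proof.
intros H x hx P [eps hP].
destruct (is_derive_on_elim _ _ _ _ 1 (H x hx) Rlt_0_1) as (d & hd & K).
assert (hM : 0 < 1 + Rabs (f' x)) by (assert (h := Rabs_pos (f' x)); lra).
assert (hd' : 0 < Rmin d (eps / (1 + Rabs (f' x)))).
{ apply Rmin_glb_lt; auto; apply Rdiv_lt_0_compat; auto; apply cond_pos. }
exists (mkposreal _ hd'); intros y hy Dy; apply hP.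
change (Rabs (y - x) < Rmin d (eps / (1 + Rabs (f' x)))) in hy.
change (Rabs (f y - f x) < eps).
specialize (K y Dy (Rlt_le_trans _ _ _ hy (Rmin_l _ _))).
assert (h2 := Rlt_le_trans _ _ _ hy (Rmin_r _ _)).
apply (Rmult_lt_compat_r _ _ _ hM) in h2.
replace (eps / (1 + Rabs (f' x)) * (1 + Rabs (f' x))) with (eps : R) in h2 by (field; lra).
assert (T := Rabs_triang (f y - f x - f' x * (y - x)) (f' x * (y - x))).
rewrite Rabs_mult in T.
replace (f y - f x - f' x * (y - x) + f' x * (y - x)) with (f y - f x) in T by ring.
lra.
Qed.

(** A [1]-Lipschitz map of the line onto [D] fixing [D]: precomposing with it turns a
function continuous on [D] into one continuous on the whole line. *)
Definition retraction (D : R -> Prop) (p : R -> R) : Prop :=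
  (forall x, D (p x)) /\ (forall x, D x -> p x = x) /\
  (forall x y, Rabs (p y - p x) <= Rabs (y - x)).

Definition clamp (a b x : R) : R := Rmax a (Rmin b x).

Lemma retraction_segment (a b : R) :
  a <= b -> retraction (segment a b) (clamp a b).
Proof.
intros hab; unfold retraction, segment, clamp; split; [|split].
- intros x; split; [apply Rmax_l|]; apply Rmax_lub; auto; apply Rmin_l.
- intros x [h1 h2]; rewrite Rmin_right by auto; now apply Rmax_right.
- intros x y; unfold Rmax, Rmin, Rabs.
  repeat (destruct Rle_dec || destruct Rcase_abs); lra.
Qed.

Lemma retraction_Rplus : retraction Rplus_set (Rmax 0).
Proof.
unfold retraction, Rplus_set; split; [|split].
- intros x; apply Rmax_l.
- intros x h; now apply Rmax_right.
- intros x y; unfold Rmax, Rabs.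
  repeat (destruct Rle_dec || destruct Rcase_abs); lra.
Qed.

Lemma C0_extension (D : R -> Prop) (p g : R -> R) :
  retraction D p -> continuous_on D g ->
  forall x, continuous (fun y => g (p y)) x.
Proof.
intros (h1 & h2 & h3) H x P hP.
destruct (H (p x) (h1 x) P hP) as [d hd].
exists d; intros y hy; apply hd; [|apply h1].
exact (Rle_lt_trans _ _ _ (h3 x y) hy).
Qed.

(** When [D] is an interval, the extension continues [g] beyond an endpoint by the tangent there. It reduces calculus with
one-sided derivatives to ordinary two-sided calculus, so that the mean value theorem and
the usual differentiation rules become available on closed intervals. For [x] in [D] and
[y] near [x], the error splits into the increment of [g] between [x] and the projection
of [y], and the variation of [g'] over the same distance, which is small by continuity
of [g']. *)
Lemma C1_extension (D : R -> Prop) (p g g' : R -> R) :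
  retraction D p ->
  (forall x, D x -> is_derive_on D g x (g' x)) -> continuous_on D g' ->
  exists h, (forall x, D x -> h x = g x) /\ (forall x, D x -> is_derive h x (g' x)).
Proof.
intros (h1 & h2 & h3) H Hc.
exists (fun x => g (p x) + g' (p x) * (x - p x)); split.
{ intros x hx; rewrite (h2 x hx); ring. }
intros x hx; apply is_derive_intro; intros eps he.
assert (he3 : 0 < eps / 3) by lra.
destruct (is_derive_on_elim _ _ _ _ _ (H x hx) he3) as (d & hd & K).
destruct (Hc x hx _ (locally_ball _ (mkposreal _ he3))) as [d' hd'].
exists (Rmin d d'); split; [apply Rmin_glb_lt; auto; apply cond_pos|].
intros y hy.
assert (B := h3 x y); rewrite (h2 x hx) in B |- *.
assert (hy1 := Rlt_le_trans _ _ _ hy (Rmin_l _ _)).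
assert (hy2 := Rlt_le_trans _ _ _ hy (Rmin_r _ _)).
specialize (K (p y) (h1 y) (Rle_lt_trans _ _ _ B hy1)).
specialize (hd' (p y) (Rle_lt_trans _ _ _ B hy2) (h1 y)).
change (Rabs (g' (p y) - g' x) < eps / 3) in hd'.
assert (T := Rabs_triang (g (p y) - g x - g' x * (p y - x)) ((g' (p y) - g' x) * (y - p y))).
replace (g (p y) + g' (p y) * (y - p y) - (g x + g' x * (x - x)) - g' x * (y - x)) with
 (g (p y) - g x - g' x * (p y - x) + (g' (p y) - g' x) * (y - p y)) by ring.
rewrite (Rabs_mult (g' (p y) - g' x)) in T.
assert (T2 := Rabs_triang (y - x) (- (p y - x))); rewrite Rabs_Ropp in T2.
replace (y - x + - (p y - x)) with (y - p y) in T2 by ring.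
assert (Rabs (g' (p y) - g' x) * Rabs (y - p y) <= eps / 3 * (2 * Rabs (y - x))).
{ apply Rmult_le_compat; try apply Rabs_pos; lra. }
nra.
Qed.

Lemma continuous_on_slice1 (D1 D2 : R -> Prop) (g : R -> R -> R) (x : R) :
  continuous_on (fun p : R * R => D1 (fst p) /\ D2 (snd p)) (fun p => g (fst p) (snd p)) ->
  D2 x -> continuous_on D1 (fun t => g t x).
Proof.
intros H hx t ht P hP; destruct (H (t, x) (conj ht hx) P hP) as [d hd].
exists d; intros s hs Ds; apply (hd (s, x)); [|now split].
split; [exact hs|apply ball_center].
Qed.

Lemma continuous_on_slice2 (D1 D2 : R -> Prop) (g : R -> R -> R) (t : R) :
  continuous_on (fun p : R * R => D1 (fst p) /\ D2 (snd p)) (fun p => g (fst p) (snd p)) ->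
  D1 t -> continuous_on D2 (g t).
Proof.
intros H ht x hx P hP; destruct (H (t, x) (conj ht hx) P hP) as [d hd].
exists d; intros s hs Ds; apply (hd (t, s)); [|now split].
split; [apply ball_center|exact hs].
Qed.

Lemma accumulation_segment (L x d : R) :
  0 < L -> segment 0 L x -> 0 < d -> exists y, segment 0 L y /\ y <> x /\ Rabs (y - x) < d.
Proof.
unfold segment; intros hL hx hd.
destruct (Rlt_dec x (L / 2)) as [h|h].
- assert (m1 := Rmin_l (d / 2) (L / 2)); assert (m2 := Rmin_r (d / 2) (L / 2)).
  assert (m3 : 0 < Rmin (d / 2) (L / 2)) by (apply Rmin_glb_lt; lra).
  exists (x + Rmin (d / 2) (L / 2)); split; [lra|split; [lra|]].
  rewrite Rabs_pos_eq; lra.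
- assert (m1 := Rmin_l (d / 2) (L / 2)); assert (m2 := Rmin_r (d / 2) (L / 2)).
  assert (m3 : 0 < Rmin (d / 2) (L / 2)) by (apply Rmin_glb_lt; lra).
  exists (x - Rmin (d / 2) (L / 2)); split; [lra|split; [lra|]].
  rewrite Rabs_left1; lra.
Qed.

Lemma accumulation_Rplus (t d : R) :
  Rplus_set t -> 0 < d -> exists s, Rplus_set s /\ s <> t /\ Rabs (s - t) < d.
Proof.
unfold Rplus_set; intros ht hd.
exists (t + d / 2); split; [lra|split; [lra|]]; rewrite Rabs_pos_eq; lra.
Qed.

Lemma derive_nonneg_le (g g' : R -> R) (a b : R) :
  a <= b ->
  (forall t, a <= t <= b -> is_derive g t (g' t)) ->
  (forall t, a <= t <= b -> 0 <= g' t) -> g a <= g b.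
Proof.
intros [hab|<-] Hd H; [|apply Rle_refl].
destruct (MVT_cor2 g g' a b hab) as (c & E & hc).
{ intros c hc; now apply is_derive_Reals, Hd. }
assert (0 <= g' c) by (apply H; lra).
assert (0 <= g' c * (b - a)) by (apply Rmult_le_pos; lra).
lra.
Qed.

Lemma derive_zero_eq (g : R -> R) (a b : R) :
  a <= b -> (forall t, a <= t <= b -> is_derive g t 0) -> g b = g a.
Proof.
intros [hab|<-] H; [|reflexivity].
destruct (MVT_cor2 g (fun _ => 0) a b hab) as (c & E & _); [|lra].
intros c hc; now apply is_derive_Reals, H.
Qed.

Lemma mean_value_segment (b : R) (g g' : R -> R) (r s : R) :
  (forall x, segment 0 b x -> is_derive_on (segment 0 b) g x (g' x)) ->
  continuous_on (segment 0 b) g' ->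
  0 <= r -> r < s -> s <= b ->
  exists xi, r < xi < s /\ g s - g r = g' xi * (s - r).
Proof.
intros hd hc h1 h2 h3.
destruct (C1_extension (segment 0 b) (clamp 0 b) g g') as (h & e & d); auto.
{ apply retraction_segment; lra. }
destruct (MVT_cor2 h g' r s h2) as (xi & E & hxi).
{ intros c hc'; apply is_derive_Reals, d; unfold segment; lra. }
exists xi; split; auto.
rewrite <- !e by (unfold segment; lra); exact E.
Qed.

(** The functions [f'] and [f''] are only pointwise derivatives; they agree on the segment
with the continuous ones provided by [Ck_on 2], by uniqueness of derivatives. *)
Lemma second_derivative_continuous (b : R) (f f' f'' : R -> R) :
  0 < b -> Ck_on 2 (segment 0 b) f ->
  (forall r, segment 0 b r -> is_derive_on (segment 0 b) f r (f' r)) ->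
  (forall r, segment 0 b r -> is_derive_on (segment 0 b) f' r (f'' r)) ->
  continuous_on (segment 0 b) f''.
Proof.
intros hb (_ & g1 & d1 & _ & g2 & d2 & c2 & _) hf' hf''.
assert (acc : forall x, segment 0 b x -> forall d, 0 < d ->
  exists y, segment 0 b y /\ y <> x /\ Rabs (y - x) < d).
{ intros x hx d; now apply accumulation_segment. }
assert (e1 : forall x, segment 0 b x -> f' x = g1 x).
{ intros x hx; apply (is_derive_on_unique (segment 0 b) f x); auto. }
apply (continuous_on_ext _ g2); auto.
intros x hx; apply (is_derive_on_unique (segment 0 b) f' x); auto.
apply (is_derive_on_ext _ g1); auto.
Qed.

Lemma is_derive_primitive (h : R -> R) (t : R) :
  (forall s, continuous h s) -> is_derive (RInt h 0) t (h t).
Proof.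
intros hc; apply (is_derive_RInt h (RInt h 0) 0 t); [|apply hc].
apply filter_forall; intros s; apply (RInt_correct (V := R_CompleteNormedModule)).
now apply (ex_RInt_continuous (V := R_CompleteNormedModule)).
Qed.

Lemma ex_RInt_continuous_on (L x : R) (g : R -> R) :
  continuous_on (segment 0 L) g -> segment 0 L x -> ex_RInt g 0 x.
Proof.
intros hc hx.
assert (hp := retraction_segment 0 L ltac:(unfold segment in hx; lra)).
apply (ex_RInt_ext (fun s => g (clamp 0 L s))).
- unfold segment in hx; intros s hs; rewrite Rmin_left, Rmax_right in hs by lra.
  now rewrite (proj1 (proj2 hp) s) by (unfold segment; lra).
- apply (ex_RInt_continuous (V := R_CompleteNormedModule)); intros z _.
  now apply (C0_extension (segment 0 L) (clamp 0 L)).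
Qed.

Lemma RInt_deviation_bound (L r V x : R) (g : R -> R) :
  continuous_on (segment 0 L) g -> segment 0 L x ->
  (forall s, segment 0 L s -> Rabs (g s - r) <= V) ->
  Rabs (RInt (fun s => g s - r) 0 x) <= x * V.
Proof.
intros hc hx hb; replace (x * V) with ((x - 0) * V) by ring.
apply abs_RInt_le_const; [apply hx| |].
- apply (ex_RInt_minus (V := R_NormedModule) g (fun _ => r));
    [now apply (ex_RInt_continuous_on L)|apply ex_RInt_const].
- unfold segment in *; intros s hs; apply hb; lra.
Qed.

(** The explicit solution and both of its partial derivatives have this shape; [g] is
the initial profile or its derivative, known to be continuous on the segment only. *)
Lemma continuous_on_separated_sum (L : R) (D : R -> Prop) (a1 a2 a3 g : R -> R) :
  0 <= L ->
  (forall t, continuous a1 t) -> (forall t, continuous a2 t) -> (forall t, continuous a3 t) ->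
  continuous_on (segment 0 L) g ->
  continuous_on (fun p : R * R => D (fst p) /\ segment 0 L (snd p))
    (fun p => a1 (fst p) * g (snd p) + a2 (fst p) * snd p + a3 (fst p)).
Proof.
intros hL h1 h2 h3 hg.
assert (hp := retraction_segment 0 L hL).
set (q := clamp 0 L) in *.
apply (continuous_on_ext _ (fun p : R * R => a1 (fst p) * g (q (snd p)) + a2 (fst p) * snd p + a3 (fst p))).
{ intros p [_ hx]; now rewrite (proj1 (proj2 hp)). }
apply continuous_on_forall; intros p _.
assert (cf : continuous (fst : R * R -> R) p) by apply continuous_fst.
assert (cs : continuous (snd : R * R -> R) p) by apply continuous_snd.
apply (continuous_plus (K := R_AbsRing) (V := R_NormedModule));
  [|now apply (continuous_comp fst a3)].
apply (continuous_plus (K := R_AbsRing) (V := R_NormedModule)).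
- apply (continuous_mult (K := R_AbsRing)); [now apply (continuous_comp fst a1)|].
  apply (continuous_comp snd (fun s => g (q s))); [exact cs|].
  now apply (C0_extension (segment 0 L)).
- apply (continuous_mult (K := R_AbsRing)); [now apply (continuous_comp fst a2)|exact cs].
Qed.

Lemma is_lim_exp_squeeze (g : R -> R) (l c C : R) :
  0 < c -> (forall t, 0 <= t -> Rabs (g t - l) <= C * exp (- c * t)) ->
  is_lim g p_infty l.
Proof.
intros hc hb.
assert (he : is_lim (fun t => exp (- c * t)) p_infty 0).
{ apply (is_lim_comp exp (fun t => - c * t) p_infty 0 m_infty).
  - apply is_lim_exp_m.
  - evar_last; [apply (is_lim_scal_l (fun t => t) (- c) p_infty p_infty), is_lim_id|].
    simpl; destruct (Rle_dec 0 (- c)); [exfalso; lra|reflexivity].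
  - exists 0; intros t _; discriminate. }
assert (hC : is_lim (fun t => C * exp (- c * t)) p_infty 0).
{ evar_last; [apply (is_lim_scal_l _ C), he|]; simpl; now rewrite Rmult_0_r. }
apply (is_lim_le_le_loc (fun t => l - C * exp (- c * t)) (fun t => l + C * exp (- c * t))).
- exists 0; intros t ht; assert (h := hb t ltac:(lra)); apply Rabs_le_between in h; lra.
- evar_last; [apply is_lim_minus'; [apply is_lim_const|exact hC]|]; simpl; f_equal; ring.
- evar_last; [apply is_lim_plus'; [apply is_lim_const|exact hC]|]; simpl; f_equal; ring.
Qed.

Lemma exp_neg_le_1 (a t : R) : 0 <= a -> 0 <= t -> exp (- a * t) <= 1.
Proof.
intros ha ht; assert (h : 0 <= a * t) by now apply Rmult_le_pos.
rewrite <- exp_0; replace (- a * t) with (- (a * t)) by ring.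
destruct h as [h|<-]; [left; apply exp_increasing; lra|rewrite Ropp_0; apply Rle_refl].
Qed.

(** * Scalar Lipschitz differential equations *)

Lemma exp_growth_bound (H h : R -> R) (C M t : R) :
  0 <= C -> 0 < M -> 0 <= t -> H 0 = 0 ->
  (forall s, is_derive H s (h s)) ->
  (forall s, 0 <= s -> h s <= C * exp (M * s)) ->
  H t <= C / M * exp (M * t).
Proof.
intros hC hM ht H0 hd hb.
assert (U := derive_nonneg_le (fun s => C / M * exp (M * s) - H s)
  (fun s => C * exp (M * s) - h s) 0 t ht).
cbv beta in U; rewrite H0, Rmult_0_r, exp_0 in U.
assert (hCM : 0 <= C / M) by (apply Rdiv_le_0_compat; lra).
assert (C / M * 1 - 0 <= C / M * exp (M * t) - H t); [|lra].
apply U.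
- intros s _; apply (is_derive_minus (K := R_AbsRing) (V := R_NormedModule)); [|apply hd].
  auto_derive; auto; field; lra.
- intros s hs; specialize (hb s (proj1 hs)); lra.
Qed.

(** Integration gains the factor [1 / M] in the norm weighted by [exp (- M |t|)]. This gain
makes the Picard operator a contraction on the whole line at once, with no
patching of local solutions. *)
Lemma primitive_exp_bound (h : R -> R) (C M t : R) :
  0 < M -> (forall s, continuous h s) ->
  (forall s, Rabs (h s) <= C * exp (M * Rabs s)) ->
  Rabs (RInt h 0 t) <= C / M * exp (M * Rabs t).
Proof.
intros hM hc hb.
assert (hC : 0 <= C).
{ assert (h0 := hb 0); rewrite Rabs_R0, Rmult_0_r, exp_0 in h0.
  assert (h1 := Rabs_pos (h 0)); lra. }
assert (h0 : RInt h 0 0 = 0) by apply (RInt_point (V := R_CompleteNormedModule)).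
assert (dH : forall s, is_derive (RInt h 0) s (h s)) by (intros s; now apply is_derive_primitive).
set (H := RInt h 0 : R -> R) in *; clearbody H.
assert (B : forall s, 0 <= s -> - (C * exp (M * s)) <= h s <= C * exp (M * s)).
{ intros s hs; apply Rabs_le_between; rewrite <- (Rabs_pos_eq s hs) at 2; apply hb. }
assert (B' : forall s, 0 <= s -> - (C * exp (M * s)) <= h (- s) <= C * exp (M * s)).
{ intros s hs; apply Rabs_le_between.
  rewrite <- (Rabs_pos_eq s hs) at 2; rewrite <- (Rabs_Ropp s); apply hb. }
assert (dN : forall s, is_derive (fun z => - H z) s (- h s)).
{ intros s; apply (is_derive_opp (K := R_AbsRing) (V := R_NormedModule)), dH. }
assert (dR : forall s, is_derive (fun z => H (- z)) s (- h (- s))).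
{ intros s; assert (d := dH (- s)); auto_derive; [eexists; exact d|].
  replace (Derive _ (- s)) with (h (- s)) by (symmetry; apply is_derive_unique, d); ring. }
assert (dRN : forall s, is_derive (fun z => - H (- z)) s (h (- s))).
{ intros s; rewrite <- (Ropp_involutive (h (- s))).
  apply (is_derive_opp (K := R_AbsRing) (V := R_NormedModule)), dR. }
destruct (Rle_dec 0 t) as [ht|ht].
- rewrite (Rabs_pos_eq t ht).
  assert (u1 := exp_growth_bound H h C M t hC hM ht h0 dH (fun s hs => proj2 (B s hs))).
  assert (u2 := exp_growth_bound (fun z => - H z) (fun s => - h s) C M t hC hM ht).
  cbv beta in u2; apply Rabs_le; split; [|exact u1].
  enough (- H t <= C / M * exp (M * t)) by lra.
  apply u2; [lra|exact dN|intros s hs; specialize (B s hs); lra].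
- assert (ht' : 0 <= - t) by lra.
  rewrite (Rabs_left1 t) by lra.
  assert (u1 := exp_growth_bound (fun z => H (- z)) (fun s => - h (- s)) C M (- t) hC hM ht').
  assert (u2 := exp_growth_bound (fun z => - H (- z)) (fun s => h (- s)) C M (- t) hC hM ht').
  cbv beta in u1, u2; rewrite Ropp_0, h0, Ropp_involutive in u1, u2.
  assert (H t <= C / M * exp (M * - t)).
  { apply u1; [lra|exact dR|intros s hs; specialize (B' s hs); lra]. }
  assert (- H t <= C / M * exp (M * - t)).
  { apply u2; [lra|exact dRN|intros s hs; specialize (B' s hs); lra]. }
  apply Rabs_le; lra.
Qed.

Lemma lipschitz_continuous (G : R -> R) (K : R) :
  0 < K -> (forall a b, Rabs (G a - G b) <= K * Rabs (a - b)) ->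
  forall x, continuous G x.
Proof.
intros hK hG x P [eps hP].
assert (hd : 0 < eps / K) by (apply Rdiv_lt_0_compat; auto; apply cond_pos).
exists (mkposreal _ hd); intros y hy; apply hP.
change (Rabs (y - x) < eps / K) in hy; change (Rabs (G y - G x) < eps).
apply (Rle_lt_trans _ _ _ (hG y x)).
apply (Rmult_lt_compat_l _ _ _ hK) in hy.
replace (K * (eps / K)) with (eps : R) in hy by (field; lra); lra.
Qed.

Lemma geometric_tail (C e : R) :
  0 <= C -> 0 < e -> exists N, forall n, (N <= n)%nat -> C * (1 / 2) ^ n < e.
Proof.
intros hC he.
destruct (pow_lt_1_zero (1 / 2) ltac:(rewrite Rabs_pos_eq; lra) (e / (C + 1))
  ltac:(apply Rdiv_lt_0_compat; lra)) as [N hN].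
exists N; intros n hn; specialize (hN n hn).
assert (h : 0 < (1 / 2) ^ n) by (apply pow_lt; lra).
rewrite Rabs_pos_eq in hN by lra.
apply (Rmult_lt_compat_l (C + 1)) in hN; [|lra].
replace ((C + 1) * (e / (C + 1))) with e in hN by (field; lra); lra.
Qed.

Lemma geometric_bound_zero (a C : R) :
  (forall n, Rabs a <= C * (1 / 2) ^ n) -> a = 0.
Proof.
intros H; destruct (Req_dec a 0) as [e|ne]; [exact e|exfalso].
assert (ha := Rabs_pos_lt a ne).
assert (hC : 0 <= C) by (specialize (H 0%nat); simpl in H; lra).
destruct (geometric_tail C (Rabs a) hC ha) as [N hN].
specialize (hN N (le_n N)); specialize (H N); lra.
Qed.

Fixpoint picard (G : R -> R) (n : nat) (t : R) : R :=
  match n with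
  | O => 0
  | S m => RInt (fun s => G (picard G m s)) 0 t
  end.

Section Picard.
Variables (G : R -> R) (K : R).
Hypotheses (hK : 0 < K) (hG : forall a b, Rabs (G a - G b) <= K * Rabs (a - b)).

(** With the weight [exp (2 K |t|)] the Picard operator contracts by [1 / 2];
[B * E] bounds the first iterate. *)
Let B := Rabs (G 0) / (2 * K).
Let E (t : R) := exp (2 * K * Rabs t).

Lemma continuous_lipschitz_comp (z : R -> R) :
  (forall s, continuous z s) -> forall s, continuous (fun s => G (z s)) s.
Proof.
intros hz s; apply (continuous_comp z G); [apply hz|].
now apply (lipschitz_continuous G K).
Qed.

Lemma picard_continuous (n : nat) : forall t, continuous (picard G n) t.
Proof.
induction n as [|n IH]; intros t; simpl.
- apply continuous_const.
- apply (ex_derive_continuous (K := R_AbsRing) (V := R_NormedModule)).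
  eexists; apply is_derive_primitive.
  now apply continuous_lipschitz_comp.
Qed.

Lemma RInt_lipschitz_diff (z1 z2 : R -> R) (C t : R) :
  (forall s, continuous z1 s) -> (forall s, continuous z2 s) ->
  (forall s, Rabs (z1 s - z2 s) <= C * E s) ->
  Rabs (RInt (fun s => G (z1 s)) 0 t - RInt (fun s => G (z2 s)) 0 t) <= C / 2 * E t.
Proof.
intros h1 h2 hb.
assert (c1 := continuous_lipschitz_comp z1 h1).
assert (c2 := continuous_lipschitz_comp z2 h2).
replace (RInt (fun s => G (z1 s)) 0 t - RInt (fun s => G (z2 s)) 0 t)
  with (RInt (fun s => minus (G (z1 s)) (G (z2 s))) 0 t).
2: apply (RInt_minus (V := R_CompleteNormedModule));
   now apply (ex_RInt_continuous (V := R_CompleteNormedModule)).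
replace (C / 2) with (K * C / (2 * K)) by (field; lra).
apply primitive_exp_bound; [lra| |].
- intros s; now apply (continuous_minus (K := R_AbsRing) (V := R_NormedModule)).
- intros s; apply (Rle_trans _ _ _ (hG (z1 s) (z2 s))).
  rewrite Rmult_assoc; apply Rmult_le_compat_l; [lra|apply hb].
Qed.

Lemma picard_step (n : nat) (t : R) :
  Rabs (picard G (S n) t - picard G n t) <= B * (1 / 2) ^ n * E t.
Proof.
revert t; induction n as [|n IH]; intros t.
- simpl; rewrite Rminus_0_r, Rmult_1_r; unfold B, E.
  apply primitive_exp_bound; [lra| |].
  + intros s; apply continuous_const.
  + intros s; assert (h : 1 <= exp (2 * K * Rabs s)).
    { rewrite <- exp_0.
      destruct (Req_dec (2 * K * Rabs s) 0) as [->|ne]; [lra|].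
      assert (0 <= 2 * K * Rabs s) by (apply Rmult_le_pos; [lra|apply Rabs_pos]).
      left; apply exp_increasing; lra. }
    assert (h' := Rabs_pos (G 0)); nra.
- replace (B * (1 / 2) ^ S n) with (B * (1 / 2) ^ n / 2) by (simpl; field).
  apply (RInt_lipschitz_diff (picard G (S n)) (picard G n));
    auto using picard_continuous.
Qed.

Lemma picard_cauchy (n k : nat) (t : R) :
  Rabs (picard G (n + k) t - picard G n t) <= 2 * B * (1 / 2) ^ n * E t.
Proof.
assert (h : Rabs (picard G (n + k) t - picard G n t)
            <= 2 * B * (1 / 2) ^ n * (1 - (1 / 2) ^ k) * E t).
{ induction k as [|k IH].
  - rewrite Nat.add_0_r, Rminus_diag, Rabs_R0; simpl; lra.
  - assert (S1 := picard_step (n + k) t); rewrite Nat.add_succ_r.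
    assert (T := Rabs_triang (picard G (S (n + k)) t - picard G (n + k) t)
                             (picard G (n + k) t - picard G n t)).
    replace (picard G (S (n + k)) t - picard G (n + k) t
      + (picard G (n + k) t - picard G n t))
      with (picard G (S (n + k)) t - picard G n t) in T by ring.
    rewrite pow_add in S1.
    apply (Rle_trans _ _ _ T); simpl ((1/2) ^ S k); lra. }
apply (Rle_trans _ _ _ h).
assert (0 <= B) by (apply Rdiv_le_0_compat; [apply Rabs_pos|lra]).
assert (0 < (1 / 2) ^ n) by (apply pow_lt; lra).
assert (0 < (1 / 2) ^ k) by (apply pow_lt; lra).
assert (0 < E t) by apply exp_pos.
apply Rmult_le_compat_r; [lra|].
assert (0 <= 2 * B * (1 / 2) ^ n) by (apply Rmult_le_pos; lra).
nra.
Qed.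

Lemma picard_limit (n : nat) (t : R) :
  Rabs (real (Lim_seq (fun m => picard G m t)) - picard G n t) <= 2 * B * (1 / 2) ^ n * E t.
Proof.
assert (hE : 0 < E t) by apply exp_pos.
assert (hB : 0 <= B) by (apply Rdiv_le_0_compat; [apply Rabs_pos|lra]).
destruct (proj2 (ex_lim_seq_cauchy_corr (fun m => picard G m t))) as [l hl].
{ clear n; intros eps.
  destruct (geometric_tail (4 * B * E t) eps) as [N hN];
    [apply Rmult_le_pos; lra|apply cond_pos|].
  specialize (hN N (le_n N)).
  exists N; intros n m hn hm.
  assert (C1 := picard_cauchy N (n - N) t); assert (C2 := picard_cauchy N (m - N) t).
  replace (N + (n - N))%nat with n in C1 by (symmetry; rewrite Nat.add_comm; now apply Nat.sub_add).
  replace (N + (m - N))%nat with m in C2 by (symmetry; rewrite Nat.add_comm; now apply Nat.sub_add).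
  assert (T := Rabs_triang (picard G n t - picard G N t) (- (picard G m t - picard G N t))).
  rewrite Rabs_Ropp in T.
  replace (picard G n t - picard G N t + - (picard G m t - picard G N t))
    with (picard G n t - picard G m t) in T by ring.
  lra. }
rewrite (is_lim_seq_unique _ _ hl); simpl real; apply le_epsilon; intros eps he.
apply is_lim_seq_spec in hl; destruct (hl (mkposreal _ he)) as [N hN].
specialize (hN (n + N)%nat (Nat.le_add_l _ _)); simpl in hN.
assert (C := picard_cauchy n N t).
assert (T := Rabs_triang (- (picard G (n + N) t - l)) (picard G (n + N) t - picard G n t)).
rewrite Rabs_Ropp in T.
replace (- (picard G (n + N) t - l) + (picard G (n + N) t - picard G n t))
  with (l - picard G n t) in T by ring.
lra.
Qed.

(** The iterates converge geometrically in the weighted norm, hence uniformly on bounded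
intervals, so the limit is continuous and passes under the integral. *)
Lemma lipschitz_ode_solution :
  exists y : R -> R, y 0 = 0 /\ forall t, is_derive y t (G (y t)).
Proof.
assert (hB : 0 <= B) by (apply Rdiv_le_0_compat; [apply Rabs_pos|lra]).
pose (y := fun t : R => real (Lim_seq (fun n => picard G n t))).
exists y.
assert (hy : forall t n, Rabs (y t - picard G n t) <= 2 * B * (1 / 2) ^ n * E t)
  by (intros t n; apply picard_limit).
clearbody y.
(* on the interval of radius |t| + 1 the weight is bounded, which gives uniform convergence *)
assert (yc : forall t, continuous y t).
{ intros t; apply continuity_pt_filterlim.
  assert (hr : 0 < Rabs t + 1) by (assert (h := Rabs_pos t); lra).
  apply (CVU_continuity (picard G) y 0 (mkposreal _ hr)).
  - intros eps he.
    set (e := exp (2 * K * (Rabs t + 1))).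
    assert (hE : 0 < e) by apply exp_pos.
    destruct (geometric_tail (2 * B * e) eps) as [N hN]; auto;
      [apply Rmult_le_pos; lra|].
    exists N; intros n s hn hs; specialize (hN n hn).
    unfold Boule in hs; simpl in hs; rewrite Rminus_0_r in hs.
    assert (hs' : E s < e) by (apply exp_increasing; apply Rmult_lt_compat_l; lra).
    assert (h2 : 0 < (1 / 2) ^ n) by (apply pow_lt; lra).
    assert (0 <= 2 * B * (1 / 2) ^ n) by (apply Rmult_le_pos; lra).
    specialize (hy s n).
    apply (Rle_lt_trans _ _ _ hy).
    apply Rle_lt_trans with (2 * B * (1 / 2) ^ n * e); [apply Rmult_le_compat_l; lra|lra].
  - intros n s _; apply continuity_pt_filterlim, picard_continuous.
  - unfold Boule; simpl; rewrite Rminus_0_r; lra. }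
assert (fix_y : forall t, y t = RInt (fun s => G (y s)) 0 t).
{ intros t; apply Rminus_diag_uniq.
  apply (geometric_bound_zero _ (2 * B * E t)); intros n.
  assert (h1 := hy t (S n)).
  assert (h2 := RInt_lipschitz_diff (picard G n) y (2 * B * (1 / 2) ^ n) t
    (picard_continuous n) yc).
  simpl picard in h1.
  assert (T := Rabs_triang (y t - RInt (fun s => G (picard G n s)) 0 t)
   (RInt (fun s => G (picard G n s)) 0 t - RInt (fun s => G (y s)) 0 t)).
  replace (y t - RInt (fun s => G (picard G n s)) 0 t +
   (RInt (fun s => G (picard G n s)) 0 t - RInt (fun s => G (y s)) 0 t))
   with (y t - RInt (fun s => G (y s)) 0 t) in T by ring.
  apply (Rle_trans _ _ _ T).
  assert (h3 : forall s, Rabs (picard G n s - y s) <= 2 * B * (1 / 2) ^ n * E s)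
    by (intros s; rewrite Rabs_minus_sym; apply hy).
  specialize (h2 h3); simpl ((1/2) ^ S n) in h1; lra. }
split.
- rewrite fix_y; apply (RInt_point (V := R_CompleteNormedModule)).
- intros t; apply (is_derive_ext (RInt (fun s => G (y s)) 0)).
  { intros s; symmetry; apply fix_y. }
  apply (is_derive_primitive (fun s => G (y s))).
  now apply continuous_lipschitz_comp.
Qed.

(** The function [(y1 - y2)^2 exp (- 2 K t)] is nonincreasing and starts at [0]. *)
Lemma lipschitz_ode_unique (y1 y2 : R -> R) :
  y1 0 = y2 0 ->
  (forall t, 0 <= t -> is_derive y1 t (G (y1 t))) ->
  (forall t, 0 <= t -> is_derive y2 t (G (y2 t))) ->
  forall t, 0 <= t -> y1 t = y2 t.
Proof.
intros h0 H1 H2 t ht.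
assert (D := derive_nonneg_le (fun s => - ((y1 s - y2 s) ^ 2 * exp (- (2 * K) * s)))
  (fun s => exp (- (2 * K) * s) *
     (2 * K * (y1 s - y2 s) ^ 2 - 2 * (y1 s - y2 s) * (G (y1 s) - G (y2 s)))) 0 t ht).
cbv beta in D; rewrite h0 in D.
assert (D' : - ((y2 0 - y2 0) ^ 2 * exp (- (2 * K) * 0)) <=
  - ((y1 t - y2 t) ^ 2 * exp (- (2 * K) * t))).
{ apply D.
  - intros s [hs _]; assert (d1 := H1 s hs); assert (d2 := H2 s hs).
    auto_derive.
    + repeat split; eexists; eauto.
    + replace (Derive _ s) with (G (y1 s)) by (symmetry; apply is_derive_unique, d1).
      replace (Derive _ s) with (G (y2 s)) by (symmetry; apply is_derive_unique, d2).
      ring.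
  - intros s hs; apply Rmult_le_pos; [left; apply exp_pos|].
    assert (h := hG (y1 s) (y2 s)).
    assert (h' : (y1 s - y2 s) * (G (y1 s) - G (y2 s)) <= K * (y1 s - y2 s) ^ 2).
    { apply (Rle_trans _ _ _ (Rle_abs _)); rewrite Rabs_mult.
      rewrite <- (pow2_abs (y1 s - y2 s)).
      assert (p := Rabs_pos (y1 s - y2 s)); nra. }
    lra. }
assert (hE := exp_pos (- (2 * K) * t)).
assert (sq := pow2_ge_0 (y1 t - y2 t)).
apply Rminus_diag_uniq; apply Rsqr_0_uniq; unfold Rsqr.
nra.
Qed.
End Picard.

(** * The maximal deviation and its dependence on a linear ramp *)

(** The bound [M] is needed: the supremum of an unbounded profile is infinite, and the
real part of an infinite value is [0]. *)
Lemma le_sup_dist (L : R) (g : R -> R) (r M x : R) :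
  (forall y, segment 0 L y -> Rabs (g y - r) <= M) ->
  segment 0 L x -> Rabs (g x - r) <= sup_dist L g r.
Proof.
intros hM hx; unfold sup_dist.
destruct (Lub_Rbar_correct (fun y => exists x, segment 0 L x /\ y = Rabs (g x - r))) as [ub lub].
specialize (lub (Finite M)).
assert (hl : Rbar_le (Lub_Rbar (fun y => exists x, segment 0 L x /\ y = Rabs (g x - r))) M).
{ apply lub; intros y (z & hz & ->); now apply hM. }
specialize (ub _ (ex_intro _ x (conj hx eq_refl))).
destruct (Lub_Rbar _); simpl in *; auto; contradiction.
Qed.

Lemma sup_dist_le (L : R) (g : R -> R) (r M : R) :
  0 <= L -> (forall y, segment 0 L y -> Rabs (g y - r) <= M) ->
  sup_dist L g r <= M.
Proof.
intros hL hM; unfold sup_dist.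
destruct (Lub_Rbar_correct (fun y => exists x, segment 0 L x /\ y = Rabs (g x - r))) as [ub lub].
assert (hl : Rbar_le (Lub_Rbar (fun y => exists x, segment 0 L x /\ y = Rabs (g x - r))) M).
{ apply lub; intros y (z & hz & ->); now apply hM. }
assert (h0 : segment 0 L 0) by (unfold segment; lra).
specialize (ub _ (ex_intro _ 0 (conj h0 eq_refl))).
destruct (Lub_Rbar _); simpl in *; auto; contradiction.
Qed.

Lemma sup_dist_scale (L : R) (g h : R -> R) (r r' k M : R) :
  0 <= L -> 0 < k ->
  (forall x, segment 0 L x -> Rabs (h x - r') <= M) ->
  (forall x, segment 0 L x -> g x - r = k * (h x - r')) ->
  sup_dist L g r = k * sup_dist L h r'.
Proof.
intros hL hk hM hgh.
assert (hA : forall x, segment 0 L x -> Rabs (g x - r) = k * Rabs (h x - r')).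
{ intros x hx; rewrite hgh, Rabs_mult, (Rabs_pos_eq k) by (auto; lra); reflexivity. }
apply Rle_antisym.
- apply sup_dist_le; auto; intros x hx; rewrite hA by auto.
  apply Rmult_le_compat_l; [lra|]; eapply le_sup_dist; eauto.
- apply Rmult_le_reg_l with (/ k); [now apply Rinv_0_lt_compat|].
  rewrite <- Rmult_assoc, Rinv_l, Rmult_1_l by lra.
  apply sup_dist_le; auto; intros x hx.
  apply Rmult_le_reg_l with k; auto.
  rewrite <- Rmult_assoc, Rinv_r, Rmult_1_l, <- hA by (auto; lra).
  apply (le_sup_dist L g r (k * M)); auto.
  intros z hz; rewrite hA by auto; apply Rmult_le_compat_l; auto; lra.
Qed.

(** The rescaled deviation of the closed loop is [w x + gamma x y] with [w] the initial
deviation and [y] an amplitude depending on time alone; this is its maximum over [0, L]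
(the reference value being [0]), the right-hand side of the equation satisfied by [y]. *)
Definition ramp_norm (L gamma : R) (w : R -> R) (y : R) : R :=
  sup_dist L (fun x => w x + gamma * x * y) 0.

Section RampNorm.
Variables (L gamma M : R) (w : R -> R).
Hypotheses (hL : 0 < L) (hgamma : 0 < gamma)
  (hM : forall x, segment 0 L x -> Rabs (w x) <= M).

Lemma ramp_bounded (y x : R) :
  segment 0 L x -> Rabs (w x + gamma * x * y - 0) <= M + gamma * L * Rabs y.
Proof.
intros hx; rewrite Rminus_0_r; apply (Rle_trans _ _ _ (Rabs_triang _ _)).
apply Rplus_le_compat; [now apply hM|].
unfold segment in hx.
rewrite !Rabs_mult, (Rabs_pos_eq gamma), (Rabs_pos_eq x) by lra.
apply Rmult_le_compat_r; [apply Rabs_pos|]; apply Rmult_le_compat_l; lra.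
Qed.

Lemma ramp_norm_shift (a b : R) :
  ramp_norm L gamma w a <= ramp_norm L gamma w b + gamma * L * Rabs (a - b).
Proof.
apply sup_dist_le; [lra|]; intros x hx.
assert (h := le_sup_dist L _ 0 _ x (ramp_bounded b) hx).
fold (ramp_norm L gamma w b) in h; cbv beta in h.
replace (w x + gamma * x * a - 0) with (w x + gamma * x * b - 0 + gamma * x * (a - b)) by ring.
apply (Rle_trans _ _ _ (Rabs_triang _ _)); apply Rplus_le_compat; [exact h|].
unfold segment in hx.
rewrite !Rabs_mult, (Rabs_pos_eq gamma), (Rabs_pos_eq x) by lra.
apply Rmult_le_compat_r; [apply Rabs_pos|]; apply Rmult_le_compat_l; lra.
Qed.

Lemma ramp_norm_lipschitz (a b : R) :
  Rabs (ramp_norm L gamma w a - ramp_norm L gamma w b) <= gamma * L * Rabs (a - b).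
Proof.
assert (h1 := ramp_norm_shift a b); assert (h2 := ramp_norm_shift b a).
rewrite Rabs_minus_sym in h2; apply Rabs_le; lra.
Qed.

Lemma ramp_norm_nonneg (a : R) : 0 <= ramp_norm L gamma w a.
Proof.
assert (h0 : segment 0 L 0) by (unfold segment; lra).
apply (Rle_trans _ _ _ (Rabs_pos (w 0 + gamma * 0 * a - 0))).
exact (le_sup_dist L _ 0 _ 0 (ramp_bounded a) h0).
Qed.
End RampNorm.

(** * Choice of the gains *)

(** The expression required to be nonnegative is, up to a positive factor, the time
derivative of the monotone part of the gap between [f (rho)] and the feedback flow (see
[flow_admissible]). Its first term is [sigma * E r] with [E r = f r - f rho_star - f' r (r - rho_star)],
which is nonnegative by concavity and stays above [E r1 > 0] for [r >= r1], where
[r1] is the midpoint of [rho_star] and [rho_cr]. For [r <= r1] the factor [f' r] is at least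
[f' r1 > 0], and the second term is nonnegative as soon as [sigma L <= f' r1]. For [r >= r1]
the second term may be negative, but it is proportional to [gamma], whereas the first one is
at least [sigma * E r1]: a small ratio [g = gamma / sigma] suffices. *)
Lemma choose_gains (L rho_max rho_cr rho_star : R) (f f' : R -> R) :
  0 < L -> 0 < rho_star < rho_cr -> rho_cr < rho_max -> 0 < f rho_star ->
  (forall r s, 0 <= r -> r < s -> s <= rho_max ->
     exists xi, r < xi < s /\ f s - f r = f' xi * (s - r)) ->
  (forall r s, 0 <= r -> r < s -> s <= rho_max -> f' s < f' r) ->
  (forall r, 0 <= r < rho_cr -> 0 < f' r) ->
  exists sigma gamma,
    0 < sigma /\ 0 < gamma /\ gamma * L < sigma /\
    2 * sigma * L * rho_max < f rho_star /\
    forall r x v, segment 0 rho_max r -> segment 0 L x -> segment 0 rho_max v ->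
      0 <= sigma * (f r - f rho_star - f' r * (r - rho_star))
           + gamma * x * v * (f' r - x * (sigma + gamma * L) / 2).
Proof.
intros hL hstar hcr hfs mvt decr pos.
set (E := fun r => f r - f rho_star - f' r * (r - rho_star)).
set (r1 := (rho_star + rho_cr) / 2).
assert (hr1 : rho_star < r1 < rho_cr) by (unfold r1; lra).
assert (ha : 0 < f' r1) by (apply pos; lra).
assert (E1 : 0 < E r1).
{ destruct (mvt rho_star r1) as (xi & hxi & e); try lra.
  assert (h := decr xi r1 ltac:(lra) ltac:(lra) ltac:(lra)).
  unfold E; rewrite e.
  replace (f' xi * (r1 - rho_star) - f' r1 * (r1 - rho_star))
    with ((f' xi - f' r1) * (r1 - rho_star)) by ring.
  apply Rmult_lt_0_compat; lra. }
assert (E0 : forall r, segment 0 rho_max r -> 0 <= E r).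
{ intros r [h1 h2]; unfold E; destruct (Rtotal_order r rho_star) as [h|[->|h]].
  - destruct (mvt r rho_star) as (xi & hxi & e); try lra.
    assert (h' := decr r xi ltac:(lra) ltac:(lra) ltac:(lra)).
    replace (f r - f rho_star) with (- (f rho_star - f r)) by ring; rewrite e.
    assert (0 <= (f' r - f' xi) * (rho_star - r)) by (apply Rmult_le_pos; lra).
    lra.
  - lra.
  - destruct (mvt rho_star r) as (xi & hxi & e); try lra.
    assert (h' := decr xi r ltac:(lra) ltac:(lra) ltac:(lra)).
    rewrite e.
    assert (0 <= (f' xi - f' r) * (r - rho_star)) by (apply Rmult_le_pos; lra).
    lra. }
assert (E2 : forall r, r1 <= r <= rho_max -> E r1 <= E r).
{ intros r [[h1|<-] h2]; [|lra].
  destruct (mvt r1 r) as (xi & hxi & e); try lra.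
  assert (h' := decr xi r ltac:(lra) ltac:(lra) ltac:(lra)).
  assert (h'' := decr r1 r ltac:(lra) ltac:(lra) ltac:(lra)).
  assert (0 <= (f' xi - f' r) * (r - r1)) by (apply Rmult_le_pos; lra).
  assert (0 <= (f' r1 - f' r) * (r1 - rho_star)) by (apply Rmult_le_pos; lra).
  unfold E; replace (f r) with (f r1 + f' xi * (r - r1)) by lra; lra. }
assert (hfM : forall r, r <= rho_max -> 0 <= r -> - Rabs (f' rho_max) <= f' r).
{ intros r [h|<-] h'.
  - assert (h'' := decr r rho_max h' h ltac:(lra)).
    assert (h3 := Rle_abs (- f' rho_max)); rewrite Rabs_Ropp in h3; lra.
  - assert (h3 := Rle_abs (- f' r)); rewrite Rabs_Ropp in h3; lra. }
set (m := Rabs (f' rho_max)) in *.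
assert (hm : 0 <= m) by apply Rabs_pos.
set (a := f' r1) in *; set (k := E r1) in *.
assert (hrm : 0 < rho_max) by lra.
assert (hLr : 0 < L * rho_max) by (apply Rmult_lt_0_compat; lra).
(* the first bound serves densities below r1, the second one keeps the flow positive *)
set (sigma := Rmin (a / L) (f rho_star / (4 * (L * rho_max)))).
assert (hs : 0 < sigma).
{ apply Rmin_glb_lt; apply Rdiv_lt_0_compat; lra. }
assert (hs1 : sigma * L <= a).
{ apply (Rle_trans _ (a / L * L)); [|right; field; lra].
  apply Rmult_le_compat_r; [lra|apply Rmin_l]. }
assert (hs2 : sigma * (4 * (L * rho_max)) <= f rho_star).
{ apply (Rle_trans _ (f rho_star / (4 * (L * rho_max)) * (4 * (L * rho_max))));
    [|right; field; lra].
  apply Rmult_le_compat_r; [lra|apply Rmin_r]. }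
assert (hq : 0 < L * rho_max * (m + a)) by (apply Rmult_lt_0_compat; lra).
(* the first bound gives gamma L < sigma, the second one serves densities above r1 *)
set (g := Rmin (1 / (2 * L)) (k / (L * rho_max * (m + a)))).
assert (hg : 0 < g).
{ apply Rmin_glb_lt; apply Rdiv_lt_0_compat; lra. }
assert (hg1 : g * (2 * L) <= 1).
{ apply (Rle_trans _ (1 / (2 * L) * (2 * L))); [|right; field; lra].
  apply Rmult_le_compat_r; [lra|apply Rmin_l]. }
assert (hg2 : g * (L * rho_max * (m + a)) <= k).
{ apply (Rle_trans _ (k / (L * rho_max * (m + a)) * (L * rho_max * (m + a))));
    [|right; field; lra].
  apply Rmult_le_compat_r; [lra|apply Rmin_r]. }
clearbody sigma g.
assert (hgL : sigma * g * L <= sigma / 2).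
{ replace (sigma * g * L) with (sigma * (g * (2 * L)) / 2) by field.
  assert (sigma * (g * (2 * L)) <= sigma * 1) by (apply Rmult_le_compat_l; lra); lra. }
exists sigma, (sigma * g); repeat split.
- exact hs.
- now apply Rmult_lt_0_compat.
- lra.
- lra.
- intros r x v hr hx hv; fold (E r).
  assert (hE := E0 r hr); unfold segment in *.
  assert (hgam : 0 < sigma * g) by now apply Rmult_lt_0_compat.
  set (gam := sigma * g) in *.
  assert (hxv0 : 0 <= x * v) by (apply Rmult_le_pos; lra).
  assert (hxv : x * v <= L * rho_max) by (apply Rmult_le_compat; lra).
  assert (hgxv : 0 <= gam * x * v) by (rewrite Rmult_assoc; apply Rmult_le_pos; lra).
  assert (hxs : x * (sigma + gam * L) / 2 <= a).
  { assert (x * (sigma + gam * L) <= L * (2 * sigma)) by (apply Rmult_le_compat; nra).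
    lra. }
  destruct (Rle_dec r r1) as [hle|hgt].
  + assert (a <= f' r).
    { destruct hle as [hlt| ->]; [|unfold a; lra].
      assert (h := decr r r1 ltac:(lra) hlt ltac:(lra)); unfold a; lra. }
    apply Rplus_le_le_0_compat; apply Rmult_le_pos; lra.
  + assert (hk : k <= E r) by (apply E2; lra).
    assert (hf' := hfM r ltac:(lra) ltac:(lra)).
    assert (h1 : sigma * k <= sigma * E r) by (apply Rmult_le_compat_l; lra).
    assert (h2 : gam * x * v * (- (m + a)) <= gam * x * v * (f' r - x * (sigma + gam * L) / 2))
      by (apply Rmult_le_compat_l; lra).
    assert (h3 : sigma * (g * (L * rho_max * (m + a))) <= sigma * k)
      by (apply Rmult_le_compat_l; lra).
    assert (h4 : gam * (m + a) * (x * v) <= gam * (m + a) * (L * rho_max)).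
    { apply Rmult_le_compat_l; auto; apply Rmult_le_pos; lra. }
    unfold gam in h2, h4 |- *; lra.
Qed.

(** * The closed loop as a scalar equation *)

Lemma feedback_flow_derive (L rho_star sigma gamma : R) (f r : R -> R) (x : R) :
  continuous_on (segment 0 L) r -> segment 0 L x ->
  is_derive_on (segment 0 L) (feedback_flow L rho_star sigma gamma f r) x
    (sigma * (r x - rho_star) - gamma * x * sup_dist L r rho_star).
Proof.
intros hc hx.
assert (hL : 0 <= L) by (unfold segment in hx; lra).
assert (hp := retraction_segment 0 L hL).
set (p := clamp 0 L) in *.
assert (pid : forall s, segment 0 L s -> p s = s) by apply hp.
assert (rc : forall s, continuous (fun s => r (p s) - rho_star) s).
{ intros s; apply (continuous_minus (K := R_AbsRing) (V := R_NormedModule) (fun s => r (p s)));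
    [now apply (C0_extension (segment 0 L))|apply continuous_const]. }
apply (is_derive_is_derive_on _ (fun y => f rho_star
  + sigma * RInt (fun s => r (p s) - rho_star) 0 y
  - gamma * (y ^ 2 / 2) * sup_dist L r rho_star)); auto.
- intros y hy; unfold feedback_flow; f_equal; f_equal; f_equal; apply RInt_ext.
  unfold segment in hy; intros s hs; rewrite Rmin_left, Rmax_right in hs by lra.
  now rewrite pid by (unfold segment; lra).
- assert (d := is_derive_primitive _ x rc); cbv beta in d; rewrite (pid x hx) in d.
  change (is_derive (fun y => RInt (fun s => r (p s) - rho_star) 0 y) x (r x - rho_star)) in d.
  set (J := RInt (fun s => r (p s) - rho_star) 0) in *; clearbody J.
  auto_derive; [eexists; exact d|].
  replace (Derive _ x) with (r x - rho_star) by (symmetry; apply is_derive_unique, d).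
  field.
Qed.

Lemma feedback_u_flow (L rho_star sigma gamma : R) (f : R -> R) (rho : R -> R -> R) (t x : R) :
  0 < f (rho t x) ->
  feedback_u L rho_star sigma gamma f rho t x * f (rho t x)
  = feedback_flow L rho_star sigma gamma f (rho t) x.
Proof. intros h; unfold feedback_u; field; lra. Qed.

Lemma sup_dist_ramp (L gamma M rho_star k y : R) (w r : R -> R) :
  0 < L -> 0 < gamma -> 0 < k ->
  (forall x, segment 0 L x -> Rabs (w x) <= M) ->
  (forall x, segment 0 L x -> r x - rho_star = k * (w x + gamma * x * y)) ->
  sup_dist L r rho_star = k * ramp_norm L gamma w y.
Proof.
intros hL hg hk hM hr; unfold ramp_norm.
apply (sup_dist_scale L r _ rho_star 0 k (M + gamma * L * Rabs y)); try lra.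
- now apply ramp_bounded.
- intros x hx; rewrite hr by auto; ring.
Qed.

(** The flow [u f(rho)] is the feedback flow, so the conservation law reads
[rho_t = - sigma (rho - rho_star) + gamma x v(t)], with [v] the maximal deviation. Hence
[exp (sigma t) (rho - rho_star)] has time derivative [gamma x exp (sigma t) v(t)], in which
[x] is only a factor. Reading the amplitude [y] off at [x = L] therefore determines
the solution at every [x], and taking the maximum over [x] closes the equation for [y].
Uniqueness of the solution follows. *)
Lemma classical_solution_is_ramp (L rho_max rho_star sigma gamma : R) (f rho0 : R -> R) (rho : R -> R -> R) :
  0 < L -> 0 < gamma ->
  (forall r, lopen_segment 0 rho_max r -> 0 < f r) ->
  is_classical_solution L rho_max rho_star sigma gamma f rho0 rho ->
  exists y : R -> R, y 0 = 0 /\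
    (forall t, 0 <= t -> is_derive y t (ramp_norm L gamma (fun x => rho0 x - rho_star) (y t))) /\
    (forall t x, 0 <= t -> segment 0 L x ->
       rho t x = rho_star + exp (- sigma * t) * (rho0 x - rho_star + gamma * x * y t)).
Proof.
intros hL hg fpos [[rho_cont (g1 & g2 & hder & [g1_cont _] & _)] hrange hpde _ hinit].
pose (v := fun t => sup_dist L (rho t) rho_star).
assert (hg1 : forall t x, Rplus_set t -> segment 0 L x ->
  g1 t x = - sigma * (rho t x - rho_star) + gamma * x * v t).
{ intros t x ht hx; destruct (hpde t x ht hx) as (dt & dx & d1 & d2 & e).
  assert (e1 : g1 t x = dt).
  { apply (is_derive_on_unique Rplus_set (fun s => rho s x) t);
      [intros d; now apply accumulation_Rplus|apply (hder t x ht hx)|exact d1]. }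
  assert (e2 : dx = sigma * (rho t x - rho_star) - gamma * x * v t).
  { apply (is_derive_on_unique (segment 0 L) (feedback_flow L rho_star sigma gamma f (rho t)) x);
      [intros d; now apply accumulation_segment| |].
    - eapply is_derive_on_ext; [exact hx| |exact d2].
      intros z hz; symmetry; apply feedback_u_flow; auto.
    - apply feedback_flow_derive; auto.
      now apply (continuous_on_slice2 Rplus_set). }
  lra. }
assert (ext : forall x, segment 0 L x -> exists h,
  (forall t, 0 <= t -> h t = rho t x) /\
  (forall t, 0 <= t -> is_derive h t (- sigma * (rho t x - rho_star) + gamma * x * v t))).
{ intros x hx.
  destruct (C1_extension Rplus_set (Rmax 0) (fun t => rho t x) (fun t => g1 t x)) as (h & h1 & h2).
  - exact retraction_Rplus.
  - intros t ht; apply (hder t x ht hx).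
  - now apply (continuous_on_slice1 _ (segment 0 L)).
  - exists h; split; auto; intros t ht; rewrite <- hg1 by auto; auto. }
assert (hLL : segment 0 L L) by (unfold segment; lra).
destruct (ext L hLL) as (h & h1 & h2).
pose (y := fun t => (exp (sigma * t) * (h t - rho_star) - (rho0 L - rho_star)) / (gamma * L)).
assert (hgL : 0 < gamma * L) by now apply Rmult_lt_0_compat.
assert (y0 : y 0 = 0).
{ unfold y; rewrite h1, hinit, Rmult_0_r, exp_0 by (auto; lra); field; lra. }
assert (dy : forall t, 0 <= t -> is_derive y t (exp (sigma * t) * v t)).
{ intros t ht; assert (d := h2 t ht); unfold y; auto_derive; [eexists; exact d|].
  replace (Derive _ t) with (- sigma * (rho t L - rho_star) + gamma * L * v t)
    by (symmetry; apply is_derive_unique, d).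
  rewrite h1 by auto; field; lra. }
assert (form : forall t x, 0 <= t -> segment 0 L x ->
  rho t x = rho_star + exp (- sigma * t) * (rho0 x - rho_star + gamma * x * y t)).
{ intros t x ht hx; destruct (ext x hx) as (k & k1 & k2).
  assert (e := derive_zero_eq (fun s => exp (sigma * s) * (k s - rho_star) - gamma * x * y s) 0 t ht).
  cbv beta in e; rewrite y0, Rmult_0_r, exp_0, !k1, hinit in e by (auto; lra).
  assert (e' : exp (sigma * t) * (rho t x - rho_star) - gamma * x * y t
     = 1 * (rho0 x - rho_star) - gamma * x * 0).
  { apply e; intros s [hs _]; assert (d := k2 s hs); assert (d' := dy s hs).
    clearbody y; auto_derive; [split; [eexists; exact d|split; [eexists; exact d'|exact I]]|].
    replace (Derive (fun x => k x) s) with (- sigma * (rho s x - rho_star) + gamma * x * v s)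
      by (symmetry; apply is_derive_unique, d).
    replace (Derive (fun x => y x) s) with (exp (sigma * s) * v s)
      by (symmetry; apply is_derive_unique, d').
    rewrite k1 by auto; ring. }
  replace (rho0 x - rho_star + gamma * x * y t) with (exp (sigma * t) * (rho t x - rho_star)) by lra.
  rewrite <- Rmult_assoc, <- exp_plus.
  replace (- sigma * t + sigma * t) with 0 by ring; rewrite exp_0; ring. }
exists y; split; [exact y0|split; [|exact form]].
intros t ht; assert (d := dy t ht).
replace (ramp_norm L gamma (fun x => rho0 x - rho_star) (y t)) with (exp (sigma * t) * v t); [exact d|].
unfold v; rewrite (sup_dist_ramp L gamma (rho_max + Rabs rho_star) rho_star (exp (- sigma * t)) (y t)
  (fun x => rho0 x - rho_star)); auto using exp_pos.
- rewrite <- Rmult_assoc, <- exp_plus.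
  replace (sigma * t + - sigma * t) with 0 by ring; rewrite exp_0; ring.
- intros x hx; rewrite <- hinit by auto.
  assert (hr := hrange 0 x (Rle_refl 0) hx); unfold lopen_segment in hr.
  apply (Rle_trans _ _ _ (Rabs_triang _ _)); rewrite Rabs_Ropp, Rabs_pos_eq; lra.
- intros x hx; rewrite form by auto; ring.
Qed.

(** * Properties of the solution *)

Section RampSolution.
Variables (L rho_star sigma gamma M : R) (rho0 y : R -> R).
Hypotheses (hL : 0 < L) (hgamma : 0 < gamma).
Let w (x : R) := rho0 x - rho_star.
Hypothesis hM : forall x, segment 0 L x -> Rabs (w x) <= M.
Hypotheses (hy0 : y 0 = 0) (hdy : forall t, is_derive y t (ramp_norm L gamma w (y t))).

Definition ramp_solution (t x : R) : R :=
  rho_star + exp (- sigma * t) * (rho0 x - rho_star + gamma * x * y t).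

Lemma sup_dist_ramp_solution (t : R) :
  sup_dist L (ramp_solution t) rho_star = exp (- sigma * t) * ramp_norm L gamma w (y t).
Proof.
apply (sup_dist_ramp L gamma M); auto using exp_pos.
intros x hx; unfold ramp_solution, w; ring.
Qed.

Lemma ramp_amplitude_nonneg (t : R) : 0 <= t -> 0 <= y t.
Proof.
intros ht; rewrite <- hy0.
apply (derive_nonneg_le y (fun s => ramp_norm L gamma w (y s))); auto.
intros s _; now apply (ramp_norm_nonneg L gamma M).
Qed.

Lemma ramp_norm_0 : ramp_norm L gamma w 0 = sup_dist L rho0 rho_star.
Proof.
rewrite (sup_dist_ramp L gamma M rho_star 1 0 w rho0); auto; try lra.
intros x _; unfold w; ring.
Qed.

(** A Gronwall estimate: [ramp_norm] grows with slope at most [gamma L], so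
[ramp_norm (y t) <= exp (gamma L t) v0], and the factor [exp (- sigma t)] wins because the
rates subtract. *)
Lemma ramp_solution_decay (t : R) :
  0 <= t ->
  sup_dist L (ramp_solution t) rho_star <= exp (- (sigma - gamma * L) * t) * sup_dist L rho0 rho_star.
Proof.
intros ht; rewrite sup_dist_ramp_solution, <- ramp_norm_0.
set (v0 := ramp_norm L gamma w 0).
assert (lip : forall s, 0 <= s -> ramp_norm L gamma w (y s) <= v0 + gamma * L * y s).
{ intros s hs; assert (h := ramp_norm_shift L gamma M w hL hgamma hM (y s) 0).
  rewrite Rminus_0_r, Rabs_pos_eq in h; [exact h|now apply ramp_amplitude_nonneg]. }
assert (D := derive_nonneg_le (fun s => - ((v0 + gamma * L * y s) * exp (- (gamma * L) * s)))
  (fun s => gamma * L * exp (- (gamma * L) * s)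
            * (v0 + gamma * L * y s - ramp_norm L gamma w (y s))) 0 t ht).
cbv beta in D; rewrite hy0, !Rmult_0_r, exp_0 in D.
assert (D' : - ((v0 + 0) * 1) <= - ((v0 + gamma * L * y t) * exp (- (gamma * L) * t))).
{ apply D.
  - intros s _; assert (d := hdy s); auto_derive; [eexists; exact d|].
    replace (Derive _ s) with (ramp_norm L gamma w (y s))
      by (symmetry; apply is_derive_unique, d).
    ring.
  - intros s [hs _]; apply Rmult_le_pos.
    + apply Rmult_le_pos; [|left; apply exp_pos]; apply Rmult_le_pos; lra.
    + specialize (lip s hs); lra. }
replace (exp (- (sigma - gamma * L) * t)) with (exp (- sigma * t) * exp (gamma * L * t))
  by (rewrite <- exp_plus; f_equal; ring).
rewrite Rmult_assoc; apply Rmult_le_compat_l; [left; apply exp_pos|].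
apply (Rle_trans _ _ _ (lip t ht)).
replace (v0 + gamma * L * y t)
  with (exp (gamma * L * t) * ((v0 + gamma * L * y t) * exp (- (gamma * L) * t))).
- apply Rmult_le_compat_l; [left; apply exp_pos|lra].
- rewrite (Rmult_comm (v0 + _)), <- Rmult_assoc, <- exp_plus.
  replace (gamma * L * t + - (gamma * L) * t) with 0 by ring; rewrite exp_0; ring.
Qed.

Lemma ramp_solution_time_derive (t x : R) :
  is_derive (fun s => ramp_solution s x) t
    (- sigma * (ramp_solution t x - rho_star) + gamma * x * sup_dist L (ramp_solution t) rho_star).
Proof.
rewrite sup_dist_ramp_solution; assert (d := hdy t); unfold ramp_solution.
auto_derive; [eexists; exact d|].
replace (Derive _ t) with (ramp_norm L gamma w (y t))
  by (symmetry; apply is_derive_unique, d).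
ring.
Qed.

Hypothesis rho0_cont : continuous_on (segment 0 L) rho0.

Lemma ramp_solution_RInt (t x : R) :
  segment 0 L x ->
  RInt (fun s => ramp_solution t s - rho_star) 0 x
  = exp (- sigma * t) * (RInt w 0 x + gamma * (x ^ 2 / 2) * y t).
Proof.
intros hx.
assert (iw : is_RInt w 0 x (RInt w 0 x)).
{ apply (RInt_correct (V := R_CompleteNormedModule)).
  apply (ex_RInt_minus (V := R_NormedModule) rho0 (fun _ => rho_star));
    [now apply (ex_RInt_continuous_on L)|apply ex_RInt_const]. }
assert (ix : is_RInt (fun s => gamma * s * y t) 0 x (gamma * (x ^ 2 / 2) * y t)).
{ replace (gamma * (x ^ 2 / 2) * y t)
    with (minus (gamma * (x ^ 2 / 2) * y t) (gamma * (0 ^ 2 / 2) * y t))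
    by (unfold minus, plus, opp; simpl; field).
  apply (is_RInt_derive (V := R_CompleteNormedModule) (fun s => gamma * (s ^ 2 / 2) * y t)).
  - intros s _; auto_derive; auto; field.
  - intros s _; apply (ex_derive_continuous (K := R_AbsRing) (V := R_NormedModule)).
    auto_derive; auto. }
apply (is_RInt_unique (V := R_CompleteNormedModule)).
apply (is_RInt_ext (V := R_NormedModule) (fun s => scal (exp (- sigma * t)) (plus (w s) (gamma * s * y t)))).
{ intros s _; unfold ramp_solution, w, scal, plus; simpl; unfold mult; simpl; ring. }
apply (is_RInt_scal (V := R_NormedModule)), (is_RInt_plus (V := R_NormedModule)); auto.
Qed.

End RampSolution.

Lemma ramp_solution_C1 (L rho_star sigma gamma M : R) (rho0 rho0' y : R -> R) :
  0 < L -> 0 < gamma ->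
  (forall x, segment 0 L x -> Rabs (rho0 x - rho_star) <= M) ->
  (forall t, is_derive y t (ramp_norm L gamma (fun x => rho0 x - rho_star) (y t))) ->
  (forall x, segment 0 L x -> is_derive_on (segment 0 L) rho0 x (rho0' x)) ->
  continuous_on (segment 0 L) rho0' ->
  Ck_on2 1 Rplus_set (segment 0 L) (ramp_solution rho_star sigma gamma rho0 y).
Proof.
intros hL hgam hM hdy hd hc.
set (V := ramp_norm L gamma (fun x => rho0 x - rho_star)) in *.
assert (cy : forall t, continuous y t).
{ intros t; apply (ex_derive_continuous (K := R_AbsRing) (V := R_NormedModule)).
  eexists; apply hdy. }
assert (cV : forall t, continuous (fun s => V (y s)) t).
{ apply (continuous_lipschitz_comp V (gamma * L)); auto.
  - now apply Rmult_lt_0_compat.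
  - now apply (ramp_norm_lipschitz L gamma M). }
assert (ce : forall t, continuous (fun s => exp (- sigma * s)) t).
{ intros t; apply (ex_derive_continuous (K := R_AbsRing) (V := R_NormedModule)).
  auto_derive; auto. }
assert (cey : forall t, continuous (fun s => exp (- sigma * s) * y s) t).
{ intros t; now apply (continuous_mult (K := R_AbsRing)). }
assert (ceV : forall t, continuous (fun s => exp (- sigma * s) * V (y s)) t).
{ intros t; now apply (continuous_mult (K := R_AbsRing)). }
assert (csc : forall (k : R) (g : R -> R), (forall t, continuous g t) -> forall t, continuous (fun s => k * g s) t).
{ intros k g hg t; now apply (continuous_scal_r (K := R_AbsRing) (V := R_NormedModule) k g). }
assert (cpl : forall (g h : R -> R), (forall t, continuous g t) -> (forall t, continuous h t) ->
   forall t, continuous (fun s => g s + h s) t).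
{ intros g h h1 h2 t; now apply (continuous_plus (K := R_AbsRing) (V := R_NormedModule)). }
assert (ck : forall (k t : R), continuous (fun _ => k) t) by (intros; apply continuous_const).
assert (c0 : continuous_on (segment 0 L) rho0) by now apply is_derive_on_continuous_on with rho0'.
split.
- apply (continuous_on_ext _ (fun p : R * R => exp (- sigma * fst p) * rho0 (snd p)
    + gamma * (exp (- sigma * fst p) * y (fst p)) * snd p
    + (rho_star + - rho_star * exp (- sigma * fst p)))).
  { intros p _; apply Rminus_diag_uniq; unfold ramp_solution; ring. }
  apply (continuous_on_separated_sum L Rplus_set (fun t => exp (- sigma * t))
    (fun t => gamma * (exp (- sigma * t) * y t)) (fun t => rho_star + - rho_star * exp (- sigma * t))); auto; lra.
- exists (fun t x => - sigma * (ramp_solution rho_star sigma gamma rho0 y t x - rho_star)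
                     + gamma * x * (exp (- sigma * t) * V (y t))).
  exists (fun t x => exp (- sigma * t) * (rho0' x + gamma * y t)).
  split; [|split; (split; [|exact I])].
  + intros t x ht hx; split.
    * apply (is_derive_is_derive_on _ (fun s => ramp_solution rho_star sigma gamma rho0 y s x)); auto.
      assert (h := ramp_solution_time_derive L rho_star sigma gamma M rho0 y hL hgam hM hdy t x).
      rewrite (sup_dist_ramp_solution L rho_star sigma gamma M) in h by auto; exact h.
    * destruct (C1_extension (segment 0 L) (clamp 0 L) rho0 rho0') as (h & h1 & h2);
        auto; [apply retraction_segment; lra|].
      apply (is_derive_is_derive_on _ (fun z => rho_star + exp (- sigma * t) * (h z - rho_star + gamma * z * y t))); auto.
      { intros z hz; unfold ramp_solution; now rewrite h1. }
      assert (d := h2 x hx); auto_derive; [eexists; exact d|].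
      replace (Derive _ x) with (rho0' x) by (symmetry; apply is_derive_unique, d).
      ring.
  + apply (continuous_on_ext _ (fun p : R * R => - sigma * exp (- sigma * fst p) * rho0 (snd p)
      + (- sigma * gamma * (exp (- sigma * fst p) * y (fst p))
         + gamma * (exp (- sigma * fst p) * V (y (fst p)))) * snd p
      + sigma * rho_star * exp (- sigma * fst p))).
    { intros p _; apply Rminus_diag_uniq; unfold ramp_solution; ring. }
    apply (continuous_on_separated_sum L Rplus_set (fun t => - sigma * exp (- sigma * t))
      (fun t => - sigma * gamma * (exp (- sigma * t) * y t) + gamma * (exp (- sigma * t) * V (y t)))
      (fun t => sigma * rho_star * exp (- sigma * t))); auto; try lra.
  + apply (continuous_on_ext _ (fun p : R * R => exp (- sigma * fst p) * rho0' (snd p)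
      + 0 * snd p + gamma * (exp (- sigma * fst p) * y (fst p)))).
    { intros p _; apply Rminus_diag_uniq; ring. }
    apply (continuous_on_separated_sum L Rplus_set (fun t => exp (- sigma * t))
      (fun _ => 0) (fun t => gamma * (exp (- sigma * t) * y t))); auto; lra.
Qed.

Section FlowBound.
Variables (L rho_star sigma gamma M rho_max : R) (rho0 y f f' : R -> R).
Hypotheses (hL : 0 < L) (hgamma : 0 < gamma) (hrm : 0 <= rho_max).
Let w (x : R) := rho0 x - rho_star.
Let rho := ramp_solution rho_star sigma gamma rho0 y.
Hypothesis hM : forall x, segment 0 L x -> Rabs (w x) <= M.
Hypotheses (hy0 : y 0 = 0) (hdy : forall t, is_derive y t (ramp_norm L gamma w (y t))).
Hypothesis rho0_cont : continuous_on (segment 0 L) rho0.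
Hypothesis f_derive : forall r, segment 0 rho_max r -> is_derive_on (segment 0 rho_max) f r (f' r).
Hypothesis f'_cont : continuous_on (segment 0 rho_max) f'.
Hypothesis gains : forall r x v, segment 0 rho_max r -> segment 0 L x -> segment 0 rho_max v ->
  0 <= sigma * (f r - f rho_star - f' r * (r - rho_star))
       + gamma * x * v * (f' r - x * (sigma + gamma * L) / 2).
Hypothesis rho_range : forall t x, 0 <= t -> segment 0 L x -> segment 0 rho_max (rho t x).
Hypothesis norm_range : forall t, 0 <= t -> segment 0 rho_max (sup_dist L (rho t) rho_star).

(** This is the invariance behind [u <= 1]. The gap [f (rho) - flow] multiplied by
[exp (sigma t)] contains [ramp_norm (y t)], which is merely Lipschitz in time, so the gap
is not differentiated directly. It is split into a differentiable part [A], from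
which the amount [gamma (x^2 / 2) gamma L y t] has been removed, and
[gamma (x^2 / 2) (ramp_norm (y t) + gamma L y t)]. The second part does not fall below its
initial value, because [ramp_norm] decreases with slope at most [gamma L] and [y t >= 0]. The
first part is nondecreasing: its derivative is [exp (sigma t)] times the
expression made nonnegative by the choice of the gains. *)
Lemma flow_admissible (x : R) :
  segment 0 L x ->
  feedback_flow L rho_star sigma gamma f rho0 x <= f (rho0 x) ->
  forall t, 0 <= t -> feedback_flow L rho_star sigma gamma f (rho t) x <= f (rho t x).
Proof.
intros hx h0 t ht.
destruct (C1_extension (segment 0 rho_max) (clamp 0 rho_max) f f')
  as (fe & fe1 & fe2); auto; [now apply retraction_segment|].
set (V := ramp_norm L gamma w) in *.
assert (A := derive_nonneg_le
  (fun s => exp (sigma * s) * (fe (rho s x) - f rho_star)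
            - gamma * (x ^ 2 / 2) * (sigma + gamma * L) * y s)
  (fun s => exp (sigma * s) *
     (sigma * (f (rho s x) - f rho_star - f' (rho s x) * (rho s x - rho_star))
      + gamma * x * sup_dist L (rho s) rho_star
        * (f' (rho s x) - x * (sigma + gamma * L) / 2))) 0 t ht).
cbv beta in A.
assert (A' : exp (sigma * 0) * (fe (rho 0 x) - f rho_star)
            - gamma * (x ^ 2 / 2) * (sigma + gamma * L) * y 0
   <= exp (sigma * t) * (fe (rho t x) - f rho_star)
            - gamma * (x ^ 2 / 2) * (sigma + gamma * L) * y t).
{ apply A.
  - intros s [hs _]; assert (d := hdy s).
    assert (dr := ramp_solution_time_derive L rho_star sigma gamma M rho0 y hL hgamma hM hdy s x).
    fold rho in dr; assert (df := fe2 (rho s x) (rho_range s x hs hx)).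
    assert (hV : V (y s) = exp (sigma * s) * sup_dist L (rho s) rho_star).
    { unfold rho; rewrite (sup_dist_ramp_solution L rho_star sigma gamma M) by auto.
      rewrite <- Rmult_assoc, <- exp_plus.
      replace (sigma * s + - sigma * s) with 0 by ring; rewrite exp_0; unfold V, w; ring. }
    rewrite hV in d.
    assert (dc := is_derive_comp (K := R_AbsRing) (V := R_NormedModule) fe (fun s => rho s x) s _ _ df dr).
    set (k := fun s => fe (rho s x)).
    change (is_derive k s ((- sigma * (rho s x - rho_star) + gamma * x * sup_dist L (rho s) rho_star)
                           * f' (rho s x))) in dc.
    assert (hk : k s = f (rho s x)) by (apply fe1; auto).
    change (is_derive (fun s => exp (sigma * s) * (k s - f rho_star)
            - gamma * (x ^ 2 / 2) * (sigma + gamma * L) * y s) s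
      (exp (sigma * s) *
     (sigma * (f (rho s x) - f rho_star - f' (rho s x) * (rho s x - rho_star))
      + gamma * x * sup_dist L (rho s) rho_star
        * (f' (rho s x) - x * (sigma + gamma * L) / 2)))).
    clearbody k; auto_derive; [split; [eexists; exact dc|split; [eexists; exact d|exact I]]|].
    replace (Derive (fun x => k x) s) with ((- sigma * (rho s x - rho_star)
      + gamma * x * sup_dist L (rho s) rho_star) * f' (rho s x))
      by (symmetry; apply is_derive_unique, dc).
    replace (Derive (fun x => y x) s) with (exp (sigma * s) * sup_dist L (rho s) rho_star)
      by (symmetry; apply is_derive_unique, d).
    rewrite hk; field.
  - intros s [hs _]; apply Rmult_le_pos; [left; apply exp_pos|].
    apply gains; auto. }
assert (r0 : rho 0 x = rho0 x).
{ unfold rho, ramp_solution; rewrite hy0, Rmult_0_r, exp_0; ring. }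
assert (sg0 : segment 0 rho_max (rho0 x)) by (rewrite <- r0; apply rho_range; auto; lra).
rewrite r0, hy0, !Rmult_0_r, exp_0, !fe1 in A' by auto.
assert (Z := ramp_norm_shift L gamma M w hL hgamma hM 0 (y t)).
assert (yt := ramp_amplitude_nonneg L rho_star gamma M rho0 y hL hgamma hM hy0 hdy t ht).
replace (Rabs (0 - y t)) with (y t) in Z
  by (rewrite Rminus_0_l, Rabs_Ropp, Rabs_pos_eq; auto).
fold V in Z.
assert (Z' : gamma * (x ^ 2 / 2) * V 0 <= gamma * (x ^ 2 / 2) * (V (y t) + gamma * L * y t)).
{ apply Rmult_le_compat_l; [|exact Z].
  apply Rmult_le_pos; [lra|]; assert (h := pow2_ge_0 x); lra. }
unfold feedback_flow in h0 |- *.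
unfold rho at 1; rewrite (ramp_solution_RInt L rho_star sigma gamma rho0 y rho0_cont t x hx).
unfold rho at 1; rewrite (sup_dist_ramp_solution L rho_star sigma gamma M) by auto.
rewrite <- (ramp_norm_0 L rho_star gamma M rho0) in h0 by auto.
change (ramp_norm L gamma (fun x => rho0 x - rho_star)) with V in h0 |- *.
change (RInt (fun s => rho0 s - rho_star) 0 x) with (RInt w 0 x) in h0 |- *.
set (J := RInt w 0 x) in *.
assert (he := exp_pos (sigma * t)).
apply Rmult_le_reg_l with (exp (sigma * t)); auto.
assert (hee : exp (sigma * t) * exp (- sigma * t) = 1).
{ rewrite <- exp_plus; replace (sigma * t + - sigma * t) with 0 by ring; apply exp_0. }
replace (exp (sigma * t) * (f rho_star + sigma * (exp (- sigma * t) * (J + gamma * (x ^ 2 / 2) * y t)) -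
 gamma * (x ^ 2 / 2) * (exp (- sigma * t) * V (y t))))
 with (exp (sigma * t) * f rho_star + (exp (sigma * t) * exp (- sigma * t)) *
   (sigma * (J + gamma * (x ^ 2 / 2) * y t) - gamma * (x ^ 2 / 2) * V (y t))) by ring.
rewrite hee; lra.
Qed.
End FlowBound.

(** * Well-posedness and convergence *)

Theorem theorem3p2
  (L rho_max q_max : R) (hL : 0 < L) (hrho_max : 0 < rho_max) (hq_max : 0 < q_max)
  (F : R -> R -> R) (ltilde : R -> R) (delta : R)
  (hF : flux_setting rho_max q_max F ltilde delta)
  (f f' f'' : R -> R)
  (hf : forall r, segment 0 rho_max r -> f r = F r 1)
  (hf_C2 : Ck_on 2 (segment 0 rho_max) f)
  (hf_range : forall r, segment 0 rho_max r -> segment 0 q_max (f r))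
  (hf' : forall r, segment 0 rho_max r ->
     is_derive_on (segment 0 rho_max) f r (f' r))
  (hf'' : forall r, segment 0 rho_max r ->
     is_derive_on (segment 0 rho_max) f' r (f'' r))
  (rho_cr : R) (hrho_cr : 0 < rho_cr < rho_max)
  (hf'_pos : forall r, 0 <= r < rho_cr -> 0 < f' r)
  (hf'_cr : f' rho_cr = 0)
  (hf''_neg : forall r, segment 0 rho_max r -> f'' r < 0)
  (hf_0 : f 0 = 0)
  (hf_pos : forall r, lopen_segment 0 rho_max r -> 0 < f r)
  (rho_star : R)
  (hrho_star : 0 < rho_star < Rmin delta (Rmin rho_cr (rho_max / 2))) :
  exists sigma gamma c : R,
    0 < sigma /\ 0 < gamma /\ 0 < c /\
    forall rho0 : R -> R,
      Ck_on 1 (segment 0 L) rho0 ->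
      (forall x, segment 0 L x -> lopen_segment 0 rho_max (rho0 x)) ->
      rho0 0 = rho_star ->
      (forall x, segment 0 L x ->
         feedback_flow L rho_star sigma gamma f rho0 x <= f (rho0 x)) ->
      exists rho : R -> R -> R,
        is_classical_solution L rho_max rho_star sigma gamma f rho0 rho /\
        (forall rho' : R -> R -> R,
           is_classical_solution L rho_max rho_star sigma gamma f rho0 rho' ->
           forall t x, Rplus_set t -> segment 0 L x -> rho' t x = rho t x) /\
        (forall t, Rplus_set t ->
           sup_dist L (rho t) rho_star <=
           exp (- c * t) * sup_dist L rho0 rho_star) /\
        (forall x, segment 0 L x ->
           is_lim (fun t => feedback_u L rho_star sigma gamma f rho t x)
             p_infty 1) /\
        (forall t x, Rplus_set t -> segment 0 L x ->
           0 < feedback_u L rho_star sigma gamma f rho t x <= 1).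
Proof.
assert (hs1 : rho_star < rho_cr).
{ apply (Rlt_le_trans _ _ _ (proj2 hrho_star)).
  apply (Rle_trans _ _ _ (Rmin_r _ _)), Rmin_l. }
assert (hs2 : rho_star < rho_max / 2).
{ apply (Rlt_le_trans _ _ _ (proj2 hrho_star)).
  apply (Rle_trans _ _ _ (Rmin_r _ _)), Rmin_r. }
apply proj1 in hrho_star.
assert (f''_cont := second_derivative_continuous rho_max f f' f'' hrho_max hf_C2 hf' hf'').
assert (f'_cont := is_derive_on_continuous_on _ f' f'' hf'').
assert (hfs : 0 < f rho_star) by (apply hf_pos; unfold lopen_segment; lra).
assert (decr : forall r s, 0 <= r -> r < s -> s <= rho_max -> f' s < f' r).
{ intros r s h1 h2 h3.
  destruct (mean_value_segment rho_max f' f'' r s) as (xi & hxi & e); auto.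
  assert (h := hf''_neg xi ltac:(unfold segment; lra)); nra. }
destruct (choose_gains L rho_max rho_cr rho_star f f')
  as (sigma & gamma & hsig & hgam & hgs & hsf & gains); auto; try lra.
{ intros r s h1 h2 h3; now apply (mean_value_segment rho_max). }
exists sigma, gamma, (sigma - gamma * L).
split; [|split; [|split]]; auto; [lra|].
intros rho0 h0C1 h0range h0star h0flow.
destruct h0C1 as (rho0_cont & rho0' & rho0_der & rho0'_cont & _).
set (w := fun x => rho0 x - rho_star).
(* rho_star < rho_max / 2 makes rho_max - rho_star bound the deviations of either sign *)
assert (hM : forall x, segment 0 L x -> Rabs (w x) <= rho_max - rho_star).
{ intros x hx; assert (h := h0range x hx); unfold lopen_segment in h.
  unfold w; apply Rabs_le; lra. }
assert (hgL : 0 < gamma * L) by now apply Rmult_lt_0_compat.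
assert (lip := ramp_norm_lipschitz L gamma (rho_max - rho_star) w hL hgam hM).
destruct (lipschitz_ode_solution (ramp_norm L gamma w) (gamma * L) hgL lip) as (y & y0 & dy).
set (rho := ramp_solution rho_star sigma gamma rho0 y).
set (v := fun t => sup_dist L (rho t) rho_star).
set (c := sigma - gamma * L).
assert (hc : 0 < c) by (unfold c; lra).
set (v0 := sup_dist L rho0 rho_star).
assert (decay : forall t, 0 <= t -> v t <= exp (- c * t) * v0).
{ exact (ramp_solution_decay L rho_star sigma gamma _ rho0 y hL hgam hM y0 dy). }
assert (v0_le : v0 <= rho_max - rho_star) by (apply sup_dist_le; auto; lra).
assert (v0_ge : 0 <= v0).
{ apply (Rle_trans _ _ _ (Rabs_pos (rho0 0 - rho_star))).
  apply (le_sup_dist L rho0 rho_star (rho_max - rho_star)); auto; unfold segment; lra. }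
assert (v_le : forall t, 0 <= t -> v t <= rho_max - rho_star).
{ intros t ht; apply (Rle_trans _ _ _ (decay t ht)).
  assert (h1 := exp_neg_le_1 c t (Rlt_le _ _ hc) ht).
  assert (h := exp_pos (- c * t)); nra. }
assert (dist_v : forall t x, segment 0 L x -> Rabs (rho t x - rho_star) <= v t).
{ intros t x hx; unfold v.
  apply (le_sup_dist L (rho t) rho_star
    (exp (- sigma * t) * (rho_max - rho_star + gamma * L * Rabs (y t)))); auto.
  intros z hz; unfold rho, ramp_solution.
  replace (rho_star + exp (- sigma * t) * (rho0 z - rho_star + gamma * z * y t) - rho_star)
    with (exp (- sigma * t) * (w z + gamma * z * y t - 0)) by (unfold w; ring).
  rewrite Rabs_mult, (Rabs_pos_eq (exp _)) by (left; apply exp_pos).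
  apply Rmult_le_compat_l; [left; apply exp_pos|now apply ramp_bounded]. }
assert (v_ge : forall t, 0 <= v t).
{ intros t; apply (Rle_trans _ _ _ (Rabs_pos (rho t 0 - rho_star))).
  apply dist_v; unfold segment; lra. }
assert (y_ge : forall t, 0 <= t -> 0 <= y t)
  by exact (ramp_amplitude_nonneg L rho_star gamma _ rho0 y hL hgam hM y0 dy).
assert (range : forall t x, 0 <= t -> segment 0 L x -> lopen_segment 0 rho_max (rho t x)).
{ intros t x ht hx; assert (h1 := dist_v t x hx); assert (h2 := v_le t ht).
  apply Rabs_le_between in h1; split; [|lra].
  assert (h3 := h0range x hx); unfold lopen_segment in h3.
  unfold rho, ramp_solution.
  assert (e0 := exp_pos (- sigma * t)).
  assert (e1 := exp_neg_le_1 sigma t (Rlt_le _ _ hsig) ht).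
  assert (h4 : 0 <= gamma * x * y t).
  { unfold segment in hx; apply Rmult_le_pos; [apply Rmult_le_pos; lra|now apply y_ge]. }
  assert (0 <= exp (- sigma * t) * (gamma * x * y t)) by (apply Rmult_le_pos; lra).
  assert (0 < exp (- sigma * t) * rho0 x) by (apply Rmult_lt_0_compat; lra).
  assert (exp (- sigma * t) * rho_star <= 1 * rho_star) by (apply Rmult_le_compat_r; lra).
  lra. }
assert (frho : forall t x, 0 <= t -> segment 0 L x -> 0 < f (rho t x)) by auto.
assert (C1 : Ck_on2 1 Rplus_set (segment 0 L) rho).
{ apply (ramp_solution_C1 L rho_star sigma gamma (rho_max - rho_star) rho0 rho0'); auto. }
assert (rho_cont : forall t, 0 <= t -> continuous_on (segment 0 L) (rho t)).
{ intros t ht; apply (continuous_on_slice2 Rplus_set); auto; apply C1. }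
(* the bound gamma L < sigma absorbs the quadratic term into the factor 2 *)
assert (flow_dist : forall t x, 0 <= t -> segment 0 L x ->
  Rabs (feedback_flow L rho_star sigma gamma f (rho t) x - f rho_star) <= 2 * sigma * L * v t).
{ intros t x ht hx.
  assert (hI := RInt_deviation_bound L rho_star (v t) x (rho t) (rho_cont t ht) hx
    (fun s => dist_v t s)); apply Rabs_le_between in hI.
  unfold feedback_flow; fold (v t).
  set (J := RInt (fun s => rho t s - rho_star) 0 x) in *; clearbody J.
  assert (hv := v_ge t); unfold segment in hx.
  assert (a1 : x * v t <= L * v t) by (apply Rmult_le_compat_r; lra).
  assert (a2 : sigma * J <= sigma * (L * v t)) by (apply Rmult_le_compat_l; lra).
  assert (a3 : sigma * - (L * v t) <= sigma * J) by (apply Rmult_le_compat_l; lra).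
  assert (a4 : gamma * (x ^ 2 / 2) <= sigma * L).
  { assert (x ^ 2 <= L ^ 2) by (apply pow_incr; lra).
    assert (gamma * (x ^ 2 / 2) <= gamma * (L ^ 2 / 2)) by (apply Rmult_le_compat_l; lra).
    assert (gamma * L * L <= sigma * L) by (apply Rmult_le_compat_r; lra).
    assert (0 <= sigma * L) by (apply Rmult_le_pos; lra).
    simpl in *; lra. }
  assert (a5 : 0 <= gamma * (x ^ 2 / 2)).
  { apply Rmult_le_pos; [lra|]; assert (h := pow2_ge_0 x); lra. }
  assert (a6 : gamma * (x ^ 2 / 2) * v t <= sigma * L * v t) by (apply Rmult_le_compat_r; lra).
  assert (a7 : 0 <= gamma * (x ^ 2 / 2) * v t) by (apply Rmult_le_pos; lra).
  assert (a8 : 0 <= sigma * L * v t) by (apply Rmult_le_pos; [apply Rmult_le_pos; lra|lra]).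
  apply Rabs_le; lra. }
assert (flow_le : forall t x, 0 <= t -> segment 0 L x ->
  feedback_flow L rho_star sigma gamma f (rho t) x <= f (rho t x)).
{ intros t x ht hx.
  apply (flow_admissible L rho_star sigma gamma (rho_max - rho_star) rho_max rho0 y f f');
    auto; try lra.
  - intros s z hs hz; assert (h := range s z hs hz); unfold lopen_segment in h.
    unfold segment; fold rho; lra.
  - intros s hs; split; [apply v_ge|]; apply (Rle_trans _ _ _ (v_le s hs)); lra. }
exists rho; split; [|split; [|split; [|split]]].
- constructor; auto.
  + intros t x ht hx.
    exists (- sigma * (rho t x - rho_star) + gamma * x * v t).
    exists (sigma * (rho t x - rho_star) - gamma * x * v t).
    split; [|split; [|ring]].
    * apply (is_derive_is_derive_on _ (fun s => rho s x)); auto.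
      now apply (ramp_solution_time_derive L rho_star sigma gamma (rho_max - rho_star)).
    * apply (is_derive_on_ext _ (feedback_flow L rho_star sigma gamma f (rho t))); auto.
      { intros z hz; apply feedback_u_flow; auto. }
      apply feedback_flow_derive; auto.
  + intros t ht; unfold rho, ramp_solution; rewrite h0star; ring.
  + intros x hx; unfold rho, ramp_solution; rewrite y0, Rmult_0_r, exp_0; ring.
- intros rho' hsol t x ht hx.
  destruct (classical_solution_is_ramp L rho_max rho_star sigma gamma f rho0 rho')
    as (y' & y'0 & dy' & form); auto.
  rewrite form by auto; unfold rho, ramp_solution.
  rewrite (lipschitz_ode_unique (ramp_norm L gamma w) (gamma * L) lip y' y); auto.
  now rewrite y'0.
- exact decay.
- intros x hx.
  destruct (C1_extension (segment 0 rho_max) (clamp 0 rho_max) f f')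
    as (fe & fe1 & fe2); auto; [apply retraction_segment; lra|].
  assert (hss : segment 0 rho_max rho_star) by (unfold segment; lra).
  apply (is_lim_ext_loc (fun t => feedback_flow L rho_star sigma gamma f (rho t) x / fe (rho t x))).
  { exists 0; intros t ht; assert (h := range t x ltac:(lra) hx); unfold lopen_segment in h.
    assert (h' := hf_pos _ h).
    unfold feedback_u; rewrite fe1 by (unfold segment; lra); field; lra. }
  evar_last; [apply (is_lim_div _ _ p_infty (f rho_star) (fe rho_star))|].
  + apply (is_lim_exp_squeeze _ _ c (2 * sigma * L * v0)); auto.
    intros t ht; apply (Rle_trans _ _ _ (flow_dist t x ht hx)).
    replace (2 * sigma * L * v0 * exp (- c * t)) with (2 * sigma * L * (exp (- c * t) * v0)) by ring.
    apply Rmult_le_compat_l; [apply Rmult_le_pos; lra|auto].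
  + apply (is_lim_comp_continuous (fun t => rho t x) fe).
    * apply (is_lim_exp_squeeze _ _ c v0); auto.
      intros t ht; apply (Rle_trans _ _ _ (dist_v t x hx)).
      rewrite Rmult_comm; auto.
    * apply (ex_derive_continuous (K := R_AbsRing) (V := R_NormedModule)).
      eexists; apply fe2, hss.
  + rewrite fe1 by auto; intros h; injection h; lra.
  + exact I.
  + rewrite fe1 by auto; simpl; f_equal; field; lra.
- intros t x ht hx.
  assert (hp := frho t x ht hx); assert (hle := flow_le t x ht hx).
  assert (hd := flow_dist t x ht hx); apply Rabs_le_between in hd.
  assert (2 * sigma * L * v t <= 2 * sigma * L * rho_max).
  { apply Rmult_le_compat_l; [apply Rmult_le_pos; lra|].
    assert (h := v_le t ht); lra. }
  unfold feedback_u.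
  replace (1 / f (rho t x) * feedback_flow L rho_star sigma gamma f (rho t) x)
    with (feedback_flow L rho_star sigma gamma f (rho t) x / f (rho t x)) by (field; lra).
  split; [apply Rdiv_lt_0_compat; lra|].
  apply Rmult_le_reg_r with (f (rho t x)); auto.
  unfold Rdiv; rewrite Rmult_assoc, Rinv_l by lra; lra.
Qed.
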